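(* Let $0<m<l$, let $\tilde b$ be the generalized batch size, $\rho\in(0,1]$, $s\in\mathbb{N}_0$, $\lambda=(\lambda_0,\dots,\lambda_s)\in\mathbb{R}^{s+1}$, and let $n_c=1+s$. The following are equivalent. (I) There exist controller parameters $A_c\in\mathbb{R}^{n_c\times n_c}$, $B_c\in\mathbb{R}^{n_c\times1}$, $C_c\in\mathbb{R}^{1\times n_c}$, $D_c\in\mathbb{R}$ with $\det\begin{pmatrix}A_c-I&B_c\\C_c&D_c\end{pmatrix}\neq0$ and a symmetric positive definite $P\in\mathbb{R}^{(n_c+1+s)\times(n_c+1+s)}$ such that, with $$A=\begin{pmatrix} A_c & B_c \\ 0 & 1 \end{pmatrix},\quad B=\begin{pmatrix} 0 \\ 1 \end{pmatrix},\quad C=\begin{pmatrix} C_c & D_c \end{pmatrix}$$ and the matrices $\mathcal{A},\mathcal{B}_1,\mathcal{B}_2,\mathcal{C},\mathcal{D}_1$ defined from $(A,B,C),\rho,\lambda$ in the context, $$0\succ\begin{pmatrix} \mathcal{A} & \mathcal{B}_1 \\ I & 0 \end{pmatrix}^\top\begin{pmatrix} P & 0 \\ 0 & -P \end{pmatrix}\begin{pmatrix} \mathcal{A} & \mathcal{B}_1 \\ I & 0 \end{pmatrix}+\begin{pmatrix} \mathcal{C} & \mathcal{D}_1 \\ 0 & 1 \end{pmatrix}^\top\begin{pmatrix} 0 & 1 \\ 1 & 0 \end{pmatrix}\begin{pmatrix} \mathcal{C} & \mathcal{D}_1 \\ 0 & 1 \end{pmatrix},$$ $$0>\mathcal{B}_2^\top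 P\mathcal{B}_2-2\tilde b\nu,\qquad \lambda_1,\dots,\lambda_s\le0,\qquad \nu=\sum_{j=0}^s\rho^{-j}\lambda_j\ge0 .$$ (II) There exist a symmetric matrix $\begin{pmatrix} P_{22} & P_{23} \\ P_{32} & P_{33} \end{pmatrix}\in\mathbb{R}^{(1+s)\times(1+s)}$ (with $P_{22}\in\mathbb{R}$, $P_{32}=P_{23}^\top$, $P_{33}\in\mathbb{R}^{s\times s}$) and $\overline P_{22}\in\mathbb{R}$ such that $$0\succ\begin{pmatrix} I & 0 \\ 0 & 1 \\ 0 & \rho^{-1} \\ A_\psi & -B_\psi \\ C_\psi & -D_\psi \end{pmatrix}^\top\begin{pmatrix} -P_{33} & 0 & 0 & 0 & 0 \\ 0 & 0 & 0 & 0 & 1 \\ 0 & 0 & P_{22} & P_{23} & 0 \\ 0 & 0 & P_{32} & P_{33} & 0 \\ 0 & 1 & 0 & 0 & 0 \end{pmatrix}\begin{pmatrix} I & 0 \\ 0 & 1 \\ 0 & \rho^{-1} \\ A_\psi & -B_\psi \\ C_\psi & -D_\psi \end{pmatrix},$$ $$0<\rho^2\overline P_{22}-\overline P_{22}+\frac{2ml}{(l-m)^2}\, q(\lambda),$$ $$0\prec\begin{pmatrix} P_{22} & P_{23} & q(\lambda) \\ P_{32} & P_{33} & -\frac{m}{l-m}\bar q(\lambda) \\ q(\lambda) & -\frac{m}{l-m}\bar q(\lambda)^\top & \overline P_{22} \end{pmatrix},$$ $$0\ge\lambda_1,\dots,\lambda_s,\qquad 0>\rho^{-2}P_{22}-2\tilde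 b\sum_{j=0}^s\rho^{-j}\lambda_j .$$
   Context: Filter matrices: for $\lambda=(\lambda_0,\dots,\lambda_s)$ let $$\left(\begin{array}{c|c} A_\psi & B_\psi \\ \hline C_\psi & D_\psi \end{array}\right)=\left(\begin{array}{cccc|c} 0 & 1 & \cdots & 0 & 0 \\ \vdots & \ddots & \ddots & \vdots & \vdots \\ 0 & \cdots & 0 & 1 & 0 \\ 0 & \cdots & 0 & 0 & 1 \\ \hline \lambda_s & \lambda_{s-1} & \cdots & \lambda_1 & \lambda_0 \end{array}\right),$$ with $A_\psi\in\mathbb{R}^{s\times s}$, $B_\psi\in\mathbb{R}^{s\times1}$, $C_\psi\in\mathbb{R}^{1\times s}$, $D_\psi=\lambda_0$. Combined system matrices: $$\mathcal{A}=\begin{pmatrix} \rho^{-1}(A+BmC) & 0 \\ (l-m)B_\psi C & A_\psi \end{pmatrix},\quad \mathcal{B}_1=\begin{pmatrix} \rho^{-1}B \\ -B_\psi \end{pmatrix},\quad \mathcal{B}_2=\begin{pmatrix} \rho^{-1}B \\ 0 \end{pmatrix},$$ $$\mathcal{C}=\begin{pmatrix} (l-m)D_\psi C & C_\psi \end{pmatrix},\quad \mathcal{D}_1=-D_\psi .$$ The functions $\bar q(\lambda)\in\mathbb{R}^s$ and $q(\lambda)\in\mathbb{R}$, linear in $\lambda$, are $$\bar q(\lambda)=\begin{pmatrix} \lambda_s \\ \rho\lambda_s+\lambda_{s-1} \\ \vdots \\ \rho^{s-1}\lambda_s+\cdots+\lambda_1 \end{pmatrix},\qquad q(\lambda)=\rho^s\lambda_s+\cdots+\rho\lambda_1+\lambda_0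 .$$ For $s=0$, all blocks with a dimension equal to $s$ (namely $A_\psi,B_\psi,C_\psi,P_{23},P_{32},P_{33},\bar q$) are empty and the corresponding rows and columns are dropped. $\tilde b>0$ is the generalized batch size of the mini-batch sampling scheme: for mini-batches of size $b$ from $\{1,\dots,N\}$, $\tilde b=b$ for uniform sampling with replacement and $\tilde b=\frac{b(N-1)}{N-b}$ for uniform sampling without replacement. $\succ,\prec$ denote definiteness of symmetric matrices. *)

(* Defs.v *)
From HB Require Import structures.
From mathcomp Require Import all_boot all_order all_algebra.
From mathcomp Require Import reals.

Set Implicit Arguments.
Unset Strict Implicit.
Unset Printing Implicit Defensive.

Import Order.TTheory GRing.Theory Num.Theory.
Local Open Scope ring_scope.

Definition posdefmx (R : realType) (n : nat) (M : 'M[R]_n) : Prop :=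
  M^T = M /\ forall x : 'cV[R]_n, x != 0 -> 0 < (x^T *m M *m x) 0 0.

Definition negdefmx (R : realType) (n : nat) (M : 'M[R]_n) : Prop :=
  M^T = M /\ forall x : 'cV[R]_n, x != 0 -> (x^T *m M *m x) 0 0 < 0.

Definition row5_mx (R : realType) (m n1 n2 n3 n4 n5 : nat)
    (M1 : 'M[R]_(m, n1)) (M2 : 'M[R]_(m, n2)) (M3 : 'M[R]_(m, n3))
    (M4 : 'M[R]_(m, n4)) (M5 : 'M[R]_(m, n5)) :
    'M[R]_(m, n1 + (n2 + (n3 + (n4 + n5)))) :=
  row_mx M1 (row_mx M2 (row_mx M3 (row_mx M4 M5))).

Definition col5_mx (R : realType) (n m1 m2 m3 m4 m5 : nat)
    (M1 : 'M[R]_(m1, n)) (M2 : 'M[R]_(m2, n)) (M3 : 'M[R]_(m3, n))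
    (M4 : 'M[R]_(m4, n)) (M5 : 'M[R]_(m5, n)) :
    'M[R]_(m1 + (m2 + (m3 + (m4 + m5))), n) :=
  col_mx M1 (col_mx M2 (col_mx M3 (col_mx M4 M5))).

(* The filter coefficients (lambda_0, ..., lambda_s) are a row vector
   [lam : 'rV_s.+1] with lambda_j = lam 0 j.  Together [psiA psiB] = [0 I_s]
   and [psiC psiD] = (lambda_s, ..., lambda_1, lambda_0). *)
Definition psiA (R : realType) (s : nat) : 'M[R]_s :=
  \matrix_(i < s, j < s) (j == i.+1 :> nat)%:R.

Definition psiB (R : realType) (s : nat) : 'cV[R]_s :=
  \col_(i < s) (i.+1 == s)%:R.

Definition psiC (R : realType) (s : nat) (lam : 'rV[R]_s.+1) : 'rV[R]_s :=
  \row_(j < s) lam 0 (inord (s - j)).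

Definition psiD (R : realType) (s : nat) (lam : 'rV[R]_s.+1) : 'M[R]_1 :=
  (lam 0 ord0)%:M.

(* Row i (counted from 0) is
   rho^i lambda_s + rho^(i-1) lambda_(s-1) + ... + lambda_(s-i). *)
Definition qbar (R : realType) (s : nat) (rho : R) (lam : 'rV[R]_s.+1) :
    'cV[R]_s :=
  \col_(i < s) \sum_(k < i.+1) rho ^+ k * lam 0 (inord (s - i + k)).

Definition q (R : realType) (s : nat) (rho : R) (lam : 'rV[R]_s.+1) : R :=
  \sum_(j < s.+1) rho ^+ j * lam 0 j.

Definition nu (R : realType) (s : nat) (rho : R) (lam : 'rV[R]_s.+1) : R :=
  \sum_(j < s.+1) rho ^- j * lam 0 j.

Definition algA (R : realType) (nc : nat) (Ac : 'M[R]_nc) (Bc : 'cV[R]_nc) :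
    'M[R]_(nc + 1) :=
  block_mx Ac Bc 0 1%:M.

Definition algB (R : realType) (nc : nat) : 'cV[R]_(nc + 1) := col_mx 0 1%:M.

Definition algC (R : realType) (nc : nat) (Cc : 'rV[R]_nc) (Dc : R) :
    'rV[R]_(nc + 1) :=
  row_mx Cc Dc%:M.

Definition calA (R : realType) (n s : nat) (m l rho : R)
    (A : 'M[R]_n) (B : 'cV[R]_n) (C : 'rV[R]_n) : 'M[R]_(n + s) :=
  block_mx (rho^-1 *: (A + m *: (B *m C))) 0
           ((l - m) *: (psiB R s *m C))    (psiA R s).

Definition calB1 (R : realType) (n s : nat) (rho : R) (B : 'cV[R]_n) :
    'cV[R]_(n + s) :=
  col_mx (rho^-1 *: B) (- psiB R s).

Definition calB2 (R : realType) (n s : nat) (rho : R) (B : 'cV[R]_n) :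
    'cV[R]_(n + s) :=
  col_mx (rho^-1 *: B) 0.

Definition calC (R : realType) (n s : nat) (m l : R) (lam : 'rV[R]_s.+1)
    (C : 'rV[R]_n) : 'rV[R]_(n + s) :=
  row_mx ((l - m) *: (psiD lam *m C)) (psiC lam).

Definition calD1 (R : realType) (s : nat) (lam : 'rV[R]_s.+1) : 'M[R]_1 :=
  - psiD lam.

Definition analysis_lmi (R : realType) (n s : nat) (m l rho : R)
    (lam : 'rV[R]_s.+1) (A : 'M[R]_n) (B : 'cV[R]_n) (C : 'rV[R]_n)
    (P : 'M[R]_(n + s)) : 'M[R]_(n + s + 1) :=
  let X := block_mx (calA s m l rho A B C) (calB1 s rho B)
                    1%:M                   0 in
  let Y := block_mx (calC m l lam C) (calD1 lam)
                    0                1%:M in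
  X^T *m block_mx P 0 0 (- P) *m X
  + Y^T *m block_mx 0 1%:M 1%:M 0 *m Y.

Definition synthesis_lmi (R : realType) (s : nat) (rho : R)
    (lam : 'rV[R]_s.+1) (P22 : R) (P23 : 'rV[R]_s) (P32 : 'cV[R]_s)
    (P33 : 'M[R]_s) : 'M[R]_(s + 1) :=
  let X : 'M[R]_(s + (1 + (1 + (s + 1))), s + 1) :=
    col5_mx (row_mx 1%:M       0)
            (row_mx 0          1%:M)
            (row_mx 0          (rho^-1)%:M)
            (row_mx (psiA R s) (- psiB R s))
            (row_mx (psiC lam) (- psiD lam)) in
  let M : 'M[R]_(s + (1 + (1 + (s + 1)))) :=
    col5_mx (row5_mx (- P33) 0    0       0   0)
            (row5_mx 0       0    0       0   1%:M)
            (row5_mx 0       0    P22%:M  P23 0)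
            (row5_mx 0       0    P32     P33 0)
            (row5_mx 0       1%:M 0       0   0) in
  X^T *m M *m X.

Definition coupling_mx (R : realType) (s : nat) (m l rho : R)
    (lam : 'rV[R]_s.+1) (P22 : R) (P23 : 'rV[R]_s) (P32 : 'cV[R]_s)
    (P33 : 'M[R]_s) (Pbar22 : R) : 'M[R]_(1 + s + 1) :=
  let v : 'cV[R]_s := - (m / (l - m)) *: qbar rho lam in
  block_mx (block_mx P22%:M P23 P32 P33) (col_mx (q rho lam)%:M v)
           (row_mx (q rho lam)%:M v^T)   Pbar22%:M.

(* Main.v *)
Require Import Defs.
From mathcomp Require Import all_boot all_order all_algebra.
From mathcomp Require Import ring lra.
From mathcomp Require Import reals.

(** Throughout, x = (eta, psi) is the plant state (the integrator of the algorithm and the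
register of the filter), xi the controller state, y the output of the algorithm, w the
input and z the filter output. Condition (I) says that the closed loop satisfies the
strict dissipation inequality with storage P and supply 2 w z; it is an output feedback
problem, in which the controller measures eta and chooses y. Eliminating the controller
leaves two conditions: one on the plant block H of P for vanishing measurement and control
(the synthesis inequality), and one on the plant block of the inverse of P. The point of the
theorem is that the second one collapses to a scalar.

The collapse comes from the vector g = (q, - m / (l - m) qbar). By Horner's rule,
sigma = g^T x obeys rho sigma' = sigma + a w + b z with a = l q / (l - m) and
b = m / (l - m), independently of the control ([coupling_vec_next]). So the vector
(rho, -1, -a, -b), with g attached to its first two entries, annihilates all trajectories.

From (I) to (II), take H as the plant block of P. The form of the dissipation inequality is
negative on trajectories, which have the largest possible dimension for that; therefore its
inverse is positive on the annihilating vector ([dual_inequality]). This reads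
rho^2 p - p + 2 a b > 0 for p = G^T P^-1 G, where G is g extended by zero. By Cauchy-Schwarz
([dotv_sqr_le]) every pbar > p makes the coupling matrix positive definite, and a pbar
slightly above p keeps the scalar inequality.

From (II) to (I), the scalar inequality provides an optimal choice of z for the storage
sigma^2 / pbar ([scalar_feedback]). The hypotheses lam_1, ..., lam_s <= 0 and nu > 0 give
the filter a stable inverse with an explicit Lyapunov function ([zero_dynamics_lyapunov]);
a small multiple of it makes the storage definite, and a feedback that knows x and w
satisfies the dissipation inequality for the resulting Ht ([state_feedback]). The coupling
condition says H > g g^T / pbar, so K = H - Ht is still positive definite. With the storage
x^T Ht x + (x - xi)^T K (x - xi), a controller that knows only (xi, eta) is as good as one
that knows everything: the problem is strictly concave in the hidden (psi, w) by the
synthesis inequality and strictly convex in the decision, so it has a saddle point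
([quadratic_elimination], [controller_exists]). Finally the determinant condition is
automatic, because a fixed point with y = 0 contradicts the decrease ([det_neq0]). *)

Set Implicit Arguments.
Unset Strict Implicit.
Unset Printing Implicit Defensive.

Import Order.TTheory GRing.Theory Num.Theory.
Local Open Scope ring_scope.

(** * Bilinear and quadratic forms *)

Section Forms.
Variable R : realType.

Definition bform (p r : nat) (M : 'M[R]_(p, r)) (x : 'cV[R]_p) (y : 'cV[R]_r) : R :=
  (x^T *m M *m y) 0 0.

Definition qform (n : nat) (M : 'M[R]_n) (x : 'cV[R]_n) : R := bform M x x.

Definition dotv (n : nat) (x y : 'cV[R]_n) : R := (x^T *m y) 0 0.

Lemma bformDl p r (M : 'M[R]_(p, r)) x1 x2 y :
  bform M (x1 + x2) y = bform M x1 y + bform M x2 y.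
Proof. by rewrite /bform raddfD /= !mulmxDl !mxE. Qed.

Lemma bformDr p r (M : 'M[R]_(p, r)) x y1 y2 :
  bform M x (y1 + y2) = bform M x y1 + bform M x y2.
Proof. by rewrite /bform mulmxDr !mxE. Qed.

Lemma bformZl p r (M : 'M[R]_(p, r)) c x y : bform M (c *: x) y = c * bform M x y.
Proof. by rewrite /bform linearZ /= -!scalemxAl mxE. Qed.

Lemma bformZr p r (M : 'M[R]_(p, r)) c x y : bform M x (c *: y) = c * bform M x y.
Proof. by rewrite /bform -scalemxAr mxE. Qed.

Lemma bform_tr p r (M : 'M[R]_(p, r)) x y : bform M^T y x = bform M x y.
Proof.
rewrite /bform; have -> : y^T *m M^T *m x = (x^T *m M *m y)^T.
  by rewrite !trmx_mul trmxK mulmxA.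
by rewrite mxE.
Qed.

Lemma bformC n (M : 'M[R]_n) x y : M^T = M -> bform M x y = bform M y x.
Proof. by move=> sM; rewrite -{1}sM bform_tr. Qed.

Lemma bform_dot p r (M : 'M[R]_(p, r)) x y : bform M x y = dotv x (M *m y).
Proof. by rewrite /bform /dotv mulmxA. Qed.

Lemma bform_mulmx p r k j (M : 'M[R]_(p, r)) (T : 'M[R]_(p, k)) (U : 'M[R]_(r, j)) x y :
  bform (T^T *m M *m U) x y = bform M (T *m x) (U *m y).
Proof. by rewrite /bform trmx_mul !mulmxA. Qed.

Lemma bformD p r (M N : 'M[R]_(p, r)) x y : bform (M + N) x y = bform M x y + bform N x y.
Proof. by rewrite /bform mulmxDr mulmxDl !mxE. Qed.

Lemma bformN p r (M : 'M[R]_(p, r)) x y : bform (- M) x y = - bform M x y.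
Proof. by rewrite /bform mulmxN mulNmx !mxE. Qed.

Lemma bformZ p r c (M : 'M[R]_(p, r)) x y : bform (c *: M) x y = c * bform M x y.
Proof. by rewrite /bform -scalemxAr -scalemxAl !mxE. Qed.

Lemma bform_block p1 p2 r1 r2 (M11 : 'M[R]_(p1, r1)) (M12 : 'M[R]_(p1, r2))
    (M21 : 'M[R]_(p2, r1)) (M22 : 'M[R]_(p2, r2)) x1 x2 y1 y2 :
  bform (block_mx M11 M12 M21 M22) (col_mx x1 x2) (col_mx y1 y2)
  = bform M11 x1 y1 + bform M12 x1 y2 + (bform M21 x2 y1 + bform M22 x2 y2).
Proof.
rewrite /bform -mulmxA mul_block_col tr_col_mx mul_row_col !mulmxDr !mulmxA !mxE.
by [].
Qed.

Lemma bform0M p r (x : 'cV[R]_p) (y : 'cV[R]_r) : bform 0 x y = 0.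
Proof. by rewrite /bform mulmx0 mul0mx mxE. Qed.

Lemma bform0l p r (M : 'M[R]_(p, r)) y : bform M 0 y = 0.
Proof. by rewrite /bform trmx0 !mul0mx mxE. Qed.

Lemma bform0r p r (M : 'M[R]_(p, r)) x : bform M x 0 = 0.
Proof. by rewrite /bform mulmx0 mxE. Qed.

Lemma dotvDr n (x y z : 'cV[R]_n) : dotv x (y + z) = dotv x y + dotv x z.
Proof. by rewrite /dotv mulmxDr mxE. Qed.

Lemma dotvZl n c (x y : 'cV[R]_n) : dotv (c *: x) y = c * dotv x y.
Proof. by rewrite /dotv linearZ /= -scalemxAl mxE. Qed.

Lemma dotvNr n (x y : 'cV[R]_n) : dotv x (- y) = - dotv x y.
Proof. by rewrite /dotv mulmxN mxE. Qed.

Lemma dotv0 n (x : 'cV[R]_n) : dotv x 0 = 0.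
Proof. by rewrite /dotv mulmx0 mxE. Qed.

Lemma dotv_sum n (x y : 'cV[R]_n) : dotv x y = \sum_i x i 0 * y i 0.
Proof. by rewrite /dotv mxE; apply: eq_bigr => i _; rewrite mxE. Qed.

Lemma dotvC n (x y : 'cV[R]_n) : dotv x y = dotv y x.
Proof. by rewrite !dotv_sum; apply: eq_bigr => i _; rewrite mulrC. Qed.

Lemma dotv_col p r (x1 y1 : 'cV[R]_p) (x2 y2 : 'cV[R]_r) :
  dotv (col_mx x1 x2) (col_mx y1 y2) = dotv x1 y1 + dotv x2 y2.
Proof. by rewrite /dotv tr_col_mx mul_row_col mxE. Qed.

Lemma dotv1 (x y : 'M[R]_1) : dotv x y = x 0 0 * y 0 0.
Proof. by rewrite dotv_sum big_ord1. Qed.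

Lemma dotv_mull n k (T : 'M[R]_(n, k)) x y : dotv (T *m x) y = dotv x (T^T *m y).
Proof. by rewrite /dotv trmx_mul mulmxA. Qed.

Lemma qformD n (M : 'M[R]_n) x y : M^T = M ->
  qform M (x + y) = qform M x + 2 * bform M x y + qform M y.
Proof. move=> sM; rewrite /qform !(bformDl, bformDr) (bformC y x sM); ring. Qed.

Lemma qformZ n (M : 'M[R]_n) c x : qform M (c *: x) = c ^+ 2 * qform M x.
Proof. by rewrite /qform bformZl bformZr mulrA expr2. Qed.

Lemma qformN n (M : 'M[R]_n) x : qform M (- x) = qform M x.
Proof. by rewrite -scaleN1r qformZ sqrrN expr1n mul1r. Qed.

Lemma qform_rank1 n (g x : 'cV[R]_n) : qform (g *m g^T) x = dotv g x ^+ 2.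
Proof.
rewrite /qform /bform mulmxA -mulmxA mxE big_ord1 -/(dotv x g) -/(dotv g x).
by rewrite dotvC expr2.
Qed.

Lemma qform_diag n (d : 'rV[R]_n) x : qform (diag_mx d) x = \sum_i d 0 i * x i 0 ^+ 2.
Proof.
rewrite /qform bform_dot dotv_sum; apply: eq_bigr => i _.
by rewrite mul_diag_mx mxE mulrCA expr2.
Qed.

Lemma sumsq_eq0 n (x : 'cV[R]_n) : \sum_i x i 0 ^+ 2 <= 0 -> x = 0.
Proof.
move=> le0; have /eqP : \sum_i x i 0 ^+ 2 = 0.
  by apply/eqP; rewrite eq_le le0 sumr_ge0 // => i _; rewrite sqr_ge0.
rewrite psumr_eq0 => [/allP h|i _]; last exact: sqr_ge0.
apply/colP => i; rewrite mxE; apply/eqP.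
by have := h i (mem_index_enum _); rewrite sqrf_eq0.
Qed.

Lemma trmx_congr p n (M : 'M[R]_p) (T : 'M[R]_(p, n)) :
  M^T = M -> (T^T *m M *m T)^T = T^T *m M *m T.
Proof. by move=> sM; rewrite !trmx_mul trmxK sM mulmxA. Qed.

End Forms.

(** * Positive definite forms *)

Section Definite.
Variable R : realType.

Lemma posdef_gt0 n (M : 'M[R]_n) x : posdefmx M -> x != 0 -> 0 < qform M x.
Proof. by move=> [_ h] /h. Qed.

Lemma posdef_ge0 n (M : 'M[R]_n) x : posdefmx M -> 0 <= qform M x.
Proof.
move=> hM; have [->|/(posdef_gt0 hM)/ltW//] := eqVneq x 0.
by rewrite /qform bform0l.
Qed.

Lemma unitmx_ker n (M : 'M[R]_n) :
  (forall x : 'cV[R]_n, M *m x = 0 -> x = 0) -> M \in unitmx.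
Proof.
(* A column kernel is a row kernel of the transpose. *)
move=> h; rewrite -unitmx_tr -row_free_unit -kermx_eq0; apply/eqP/row_matrixP => i.
rewrite row0; apply: trmx_inj; rewrite trmx0; apply: h.
by apply: trmx_inj; rewrite trmx_mul trmxK trmx0 -row_mul mulmx_ker row0.
Qed.

Lemma posdef_unit n (M : 'M[R]_n) : posdefmx M -> M \in unitmx.
Proof.
move=> hM; apply: unitmx_ker => x Mx0; apply/eqP/negPn/negP => /(posdef_gt0 hM).
by rewrite /qform bform_dot Mx0 /dotv mulmx0 mxE ltxx.
Qed.

(** Cauchy-Schwarz for the scalar product of M: since M u = g, the pairing of g with x
is the M-product of u and x, and g^T u is the M-norm of u squared. With u = M^-1 g this
gives the largest rank-one form g g^T / c below M. *)
Lemma dotv_sqr_le n (M : 'M[R]_n) g u x : posdefmx M -> M *m u = g ->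
  dotv g x ^+ 2 <= dotv g u * qform M x.
Proof.
move=> hM Mu; have sM := hM.1.
have gx : bform M x u = dotv g x by rewrite bform_dot Mu dotvC.
have gu : qform M u = dotv g u by rewrite /qform bform_dot Mu dotvC.
have pu : 0 <= dotv g u by rewrite -gu posdef_ge0.
have [u0|un0] := eqVneq u 0.
  by rewrite -Mu u0 mulmx0 /dotv trmx0 !mul0mx mxE expr0n /= mul0r.
have pu' : 0 < dotv g u by rewrite -gu posdef_gt0.
(* The discriminant argument, on x minus a multiple of u with the denominator cleared. *)
have := posdef_ge0 (dotv g u *: x + (- dotv g x) *: u) hM.
rewrite qformD // !qformZ bformZl bformZr gx gu.
have -> : dotv g u ^+ 2 * qform M x + 2 * (dotv g u * (- dotv g x * dotv g x))
    + (- dotv g x) ^+ 2 * dotv g u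
  = dotv g u * (dotv g u * qform M x - dotv g x ^+ 2) by ring.
by rewrite pmulr_rge0 // subr_ge0.
Qed.

(** Every coordinate is bounded by the form M (Cauchy-Schwarz with g a basis vector), so
any form is. The choice of the small constants below rests on this bound. *)
Lemma posdef_dominates n (M V : 'M[R]_n) : posdefmx M ->
  exists2 G, 0 <= G & forall x, qform V x <= G * qform M x.
Proof.
move=> hM; pose e (i : 'I_n) : 'cV[R]_n := delta_mx i 0.
pose c (i : 'I_n) := dotv (e i) (invmx M *m e i).
have xE (x : 'cV[R]_n) (i : 'I_n) : dotv (e i) x = x i 0.
  rewrite dotv_sum (bigD1 i) //= mxE !eqxx mul1r big1 ?addr0 // => j ji.
  by rewrite mxE (negbTE ji) mul0r.
have xc (x : 'cV[R]_n) (i : 'I_n) : x i 0 ^+ 2 <= c i * qform M x.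
  rewrite -xE; apply: dotv_sqr_le => //.
  by rewrite mulmxA mulmxV ?mul1mx // posdef_unit.
have c0 (i : 'I_n) : 0 <= c i.
  have := posdef_ge0 (invmx M *m e i) hM.
  by rewrite /qform bform_dot mulmxA mulmxV ?mul1mx ?posdef_unit // dotvC.
exists (\sum_i \sum_j `|V i j| * ((c i + c j) / 2)).
  apply: sumr_ge0 => i _; apply: sumr_ge0 => j _.
  by rewrite mulr_ge0 // divr_ge0 // addr_ge0.
move=> x; rewrite /qform bform_dot dotv_sum mulr_suml; apply: ler_sum => i _.
rewrite mxE mulr_sumr mulr_suml; apply: ler_sum => j _.
apply: (@le_trans _ _ (`|V i j| * `|x i 0 * x j 0|)).
  by rewrite -normrM mulrCA ler_norm.
rewrite -mulrA ler_wpM2l // normrM.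
(* |x_i| |x_j| is at most half of x_i^2 + x_j^2. *)
have := xc x i; have := xc x j; rewrite -[x i 0 ^+ 2]real_normK ?num_real //.
rewrite -[x j 0 ^+ 2]real_normK ?num_real //.
have := sqr_ge0 (`|x i 0| - `|x j 0|); rewrite -/(qform M x); nra.
Qed.

(** Positivity of a matrix bordered by the vector g and the number pbar, read off from the
Schur complement H - g g^T / pbar. *)
Lemma bordered_form_gt0 n (H : 'M[R]_n) pi pbar g :
  posdefmx H -> (forall x, dotv g x ^+ 2 <= pi * qform H x) -> 0 <= pi -> pi < pbar ->
  forall x (t : R), (x != 0) || (t != 0) ->
    0 < qform H x + 2 * t * dotv g x + pbar * t ^+ 2.
Proof.
move=> hH cs pi0 pip x t; have [->|xn0 _] := eqVneq x 0.
  rewrite /qform bform0l dotv0 mulr0 !add0r => tn0.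
  by rewrite mulr_gt0 ?exprn_even_gt0 // (le_lt_trans pi0).
have hx := posdef_gt0 hH xn0; have p0 := le_lt_trans pi0 pip.
rewrite -(pmulr_rgt0 _ p0).
have -> : pbar * (qform H x + 2 * t * dotv g x + pbar * t ^+ 2)
  = (pbar * t + dotv g x) ^+ 2 + (pbar * qform H x - dotv g x ^+ 2) by ring.
rewrite ltr_wpDl ?sqr_ge0 // subr_gt0 (le_lt_trans (cs x)) //.
by rewrite ltr_pM2r.
Qed.

End Definite.

(** * Saddle points of quadratic forms *)

Section Elimination.
Variable R : realType.

(** The quadratic form F(x, y, z) is strictly convex in the decision y and strictly
concave in the disturbance z, so it has a saddle point that is linear in x. At a saddle
point min max = max min: it makes no difference whether y is chosen with knowledge of z.
So if every (x, z) with x nonzero admits some y that makes F negative, then a linear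
y = L x already does so against all z. This is the step that produces a controller, which
sees x only, from a feedback law that sees everything. *)
Lemma quadratic_elimination k u d (F : 'M[R]_(k + (u + d))) :
  F^T = F ->
  (forall z : 'cV[R]_d, z != 0 -> qform F (col_mx 0 (col_mx 0 z)) < 0) ->
  (forall y : 'cV[R]_u, y != 0 -> 0 < qform F (col_mx 0 (col_mx y 0))) ->
  (forall (x : 'cV[R]_k) (z : 'cV[R]_d), x != 0 ->
     exists y : 'cV[R]_u, qform F (col_mx x (col_mx y z)) < 0) ->
  exists L : 'M[R]_(u, k), forall (x : 'cV[R]_k) (z : 'cV[R]_d), (x != 0) || (z != 0) ->
    qform F (col_mx x (col_mx (L *m x) z)) < 0.
Proof.
move=> sF Fneg Fpos Fex.
have Fpos0 (y : 'cV[R]_u) : 0 <= qform F (col_mx 0 (col_mx y 0)).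
  have [->|/Fpos/ltW//] := eqVneq y 0.
  by rewrite !col_mx0 /qform bform0l.
have Fneg0 (z : 'cV[R]_d) : qform F (col_mx 0 (col_mx 0 z)) <= 0.
  have [->|/Fneg/ltW//] := eqVneq z 0.
  by rewrite !col_mx0 /qform bform0l.
set W := drsubmx F.
have bW v w : bform F (col_mx 0 v) (col_mx 0 w) = bform W v w.
  by rewrite -(submxK F) bform_block !bform0l !bform0r !add0r.
(* If W (y, z) = 0, pairing with (y, -z) cancels the cross terms by symmetry and
   leaves F(0, y, 0) - F(0, 0, z) = 0. *)
have uW : W \in unitmx.
  apply: unitmx_ker => v; rewrite -(vsubmxK v).
  set y := usubmx v; set z := dsubmx v => Wv.
  have : bform W (col_mx y 0 - col_mx 0 z) (col_mx y 0 + col_mx 0 z) = 0.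
    by rewrite add_col_mx addr0 add0r bform_dot Wv /dotv mulmx0 mxE.
  have sW : W^T = W by rewrite /W trmx_drsub sF.
  rewrite -scaleN1r !(bformDl, bformDr, bformZl) (bformC (col_mx 0 z) _ sW) -!bW.
  rewrite -/(qform F (col_mx 0 (col_mx y 0))) -/(qform F (col_mx 0 (col_mx 0 z))).
  move=> e0; have [y0|yn0] := eqVneq y 0; have [z0|zn0] := eqVneq z 0.
  - by rewrite y0 z0 col_mx0.
  - by exfalso; have := Fneg _ zn0; have := Fpos0 y; lra.
  - by exfalso; have := Fneg0 z; have := Fpos _ yn0; lra.
  - by exfalso; have := Fneg _ zn0; have := Fpos _ yn0; lra.
(* S x is the stationary point of F(x, ., .), so F splits there without cross term. *)
pose S := - (invmx W *m dlsubmx F).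
have stat x v : bform F (col_mx x (S *m x)) (col_mx 0 v) = 0.
  rewrite (bformC _ _ sF) bform_dot -{1}(submxK F) mul_block_col.
  rewrite -/W /S mulNmx !mulmxN !mulmxA mulmxV // mul1mx subrr.
  by rewrite dotv_col /dotv trmx0 mul0mx mulmx0 !mxE addr0.
have shift x v : qform F (col_mx x (S *m x + v))
   = qform F (col_mx x (S *m x)) + qform F (col_mx 0 v).
  by rewrite -{1}[x]addr0 -add_col_mx qformD // stat mulr0 addr0.
exists (usubmx S) => x z.
have [xz|xn0 _] := eqVneq x 0.
  by rewrite xz /= mulmx0 => /Fneg.
(* At the saddle value of z any admissible y gives at least the saddle value. *)
have saddle : qform F (col_mx x (S *m x)) < 0.
  have [y] := Fex x (dsubmx S *m x) xn0.
  have -> : col_mx y (dsubmx S *m x) = S *m x + col_mx (y - usubmx S *m x) 0.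
    by rewrite -{2}(vsubmxK S) mul_col_mx add_col_mx addr0 addrCA subrr addr0.
  by rewrite shift; have := Fpos0 (y - usubmx S *m x); lra.
have -> : col_mx (usubmx S *m x) z = S *m x + col_mx 0 (z - dsubmx S *m x).
  by rewrite -{2}(vsubmxK S) mul_col_mx add_col_mx addr0 addrCA subrr addr0.
by rewrite shift; have := Fneg0 (z - dsubmx S *m x); lra.
Qed.

End Elimination.

(** * The matrix inequalities as dissipation inequalities *)

Section Plant.
Variables (R : realType) (m l rho : R) (s : nat) (lam : 'rV[R]_s.+1).

(** The closed loop without the controller: x = (eta, psi), where eta is the integrator
of the algorithm and psi the register of the filter; y is the output of the algorithm and
w the input from the gradient. The filter output z is plant_out. The factor 1/rho is the exponential weighting. *)
Definition plant_next (x : 'cV[R]_(1 + s)) (y w : 'cV[R]_1) : 'cV[R]_(1 + s) :=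
  col_mx (rho^-1 *: (usubmx x + m *: y + w))
         (psiA R s *m dsubmx x + psiB R s *m ((l - m) *: y - w)).

Lemma plant_next0 : plant_next 0 0 0 = 0.
Proof.
have u0 : usubmx (0 : 'cV[R]_(1 + s)) = 0 by rewrite linear0.
have d0 : dsubmx (0 : 'cV[R]_(1 + s)) = 0 by rewrite linear0.
by rewrite /plant_next u0 d0 !scaler0 subr0 !addr0 !mulmx0 scaler0 addr0 col_mx0.
Qed.

Definition plant_out (x : 'cV[R]_(1 + s)) (y w : 'cV[R]_1) : 'cV[R]_1 :=
  psiC lam *m dsubmx x + psiD lam *m ((l - m) *: y - w).

Definition dissipation (H : 'M[R]_(1 + s)) (x : 'cV[R]_(1 + s)) (y w : 'cV[R]_1) : R :=
  qform H (plant_next x y w) - qform H x + 2 * dotv w (plant_out x y w).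

(** The state of the closed loop lists the controller state first and splits the plant
state x = (eta, psi) differently from the type of x, which is why it is rebuilt here. *)
Definition closed_state (k : nat) (xi : 'cV[R]_k) (x : 'cV[R]_(1 + s)) :
    'cV[R]_(k + 1 + s) :=
  col_mx (col_mx xi (usubmx x)) (dsubmx x).

Lemma closed_stateP k (X : 'cV[R]_(k + 1 + s)) : exists xi x, X = closed_state xi x.
Proof.
exists (usubmx (usubmx X)), (col_mx (dsubmx (usubmx X)) (dsubmx X)).
by rewrite /closed_state col_mxKu col_mxKd !vsubmxK.
Qed.

Lemma closed_state_eq0 k (xi : 'cV[R]_k) (x : 'cV[R]_(1 + s)) :
  (closed_state xi x == 0) = (xi == 0) && (x == 0).
Proof.
by rewrite /closed_state !col_mx_eq0 -andbA -[in RHS](vsubmxK x) col_mx_eq0.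
Qed.

(** The projection to the plant state; its transpose extends by a zero controller state. *)
Definition plant_part (k : nat) : 'M[R]_(1 + s, k + 1 + s) :=
  row_mx (row_mx 0 (col_mx 1%:M 0)) (col_mx 0 1%:M).

Lemma plant_part_state k (xi : 'cV[R]_k) x : plant_part k *m closed_state xi x = x.
Proof.
rewrite /plant_part /closed_state !mul_row_col mul0mx add0r !mul_col_mx.
by rewrite !mul1mx !mul0mx add_col_mx addr0 add0r vsubmxK.
Qed.

Lemma plant_part_tr k (x : 'cV[R]_(1 + s)) : (plant_part k)^T *m x = closed_state 0 x.
Proof.
rewrite /plant_part /closed_state -{1}(vsubmxK x) !tr_row_mx !tr_col_mx.
rewrite !trmx0 !trmx1 !mul_col_mx !mul_row_col mul0mx !mul0mx !mul1mx.
by rewrite addr0 add0r.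
Qed.

Lemma dotv_state k (g : 'cV[R]_(1 + s)) (xi : 'cV[R]_k) x :
  dotv (closed_state 0 g) (closed_state xi x) = dotv g x.
Proof. by rewrite -plant_part_tr dotv_mull trmxK plant_part_state. Qed.

Lemma qform_plant_block k (P : 'M[R]_(k + 1 + s)) x :
  qform (plant_part k *m P *m (plant_part k)^T) x = qform P (closed_state 0 x).
Proof. by rewrite -{1}[plant_part k]trmxK /qform bform_mulmx plant_part_tr. Qed.

Lemma calA_state k (Ac : 'M[R]_k) Bc Cc Dc xi x w :
  calA s m l rho (algA Ac Bc) (algB R k) (algC Cc Dc) *m closed_state xi x
    + calB1 s rho (algB R k) *m w
  = closed_state (rho^-1 *: (Ac *m xi + Bc *m usubmx x))
      (plant_next x (Cc *m xi + Dc%:M *m usubmx x) w).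
Proof.
have yE : algC Cc Dc *m col_mx xi (usubmx x) = Cc *m xi + Dc%:M *m usubmx x.
  by rewrite /algC mul_row_col.
rewrite /calA /calB1 /closed_state mul_block_col mul0mx addr0.
rewrite (mul_col_mx (rho^-1 *: _)).
rewrite add_col_mx /plant_next col_mxKu col_mxKd; congr col_mx.
  rewrite -!scalemxAl -scalerDr mulmxDl -scalemxAl -mulmxA yE.
  rewrite /algA /algB mul_block_col !mul_col_mx !mul0mx !mul1mx add0r.
  rewrite -scale_col_mx; congr (_ *: _).
  by rewrite scale_col_mx scaler0 !add_col_mx !addr0.
rewrite -scalemxAl -mulmxA yE mulNmx mulmxBr -scalemxAr.
by rewrite addrAC addrC.
Qed.

Lemma calC_state k (Cc : 'rV[R]_k) Dc xi x w :
  calC m l lam (algC Cc Dc) *m closed_state xi x + calD1 lam *m w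
  = plant_out x (Cc *m xi + Dc%:M *m usubmx x) w.
Proof.
rewrite /calC /closed_state mul_row_col -scalemxAl -mulmxA /algC mul_row_col.
by rewrite /plant_out mulmxBr -scalemxAr /calD1 mulNmx addrA [psiC _ *m _ + _]addrC.
Qed.

(** The analysis inequality is the dissipation inequality of the closed loop, with
quadratic storage P. *)
Lemma analysis_qform k (Ac : 'M[R]_k) Bc Cc Dc P xi x w :
  let y := Cc *m xi + Dc%:M *m usubmx x in
  qform (analysis_lmi m l rho lam (algA Ac Bc) (algB R k) (algC Cc Dc) P)
    (col_mx (closed_state xi x) w)
  = qform P (closed_state (rho^-1 *: (Ac *m xi + Bc *m usubmx x)) (plant_next x y w))
    - qform P (closed_state xi x) + 2 * dotv w (plant_out x y w).
Proof.
move=> y; rewrite /analysis_lmi /qform bformD !bform_mulmx.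
rewrite (mul_block_col (calA s m l rho _ _ _)) (mul_block_col (calC m l lam _)).
rewrite !mul0mx !mul1mx !addr0 add0r calA_state calC_state.
rewrite !bform_block !bform0M bformN !add0r !addr0 !bform_dot !mul1mx.
by rewrite [dotv _ w]dotvC mulr2n mulrDl !mul1r.
Qed.

Lemma analysis_sym k (A : 'M[R]_k) B C (P : 'M[R]_(k + s)) : P^T = P ->
  (analysis_lmi m l rho lam A B C P)^T = analysis_lmi m l rho lam A B C P.
Proof.
move=> sP; rewrite /analysis_lmi linearD /= !trmx_congr //.
  by rewrite tr_block_mx !trmx0 trmx1.
by rewrite tr_block_mx !trmx0 linearN /= sP.
Qed.

(** The synthesis inequality is the dissipation inequality of the plant when the measured
eta and the control y both vanish. *)
Lemma synthesis_qform P22 P23 P32 P33 psi w :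
  qform (synthesis_lmi rho lam P22 P23 P32 P33) (col_mx psi w)
  = dissipation (block_mx P22%:M P23 P32 P33) (col_mx 0 psi) 0 w.
Proof.
rewrite /synthesis_lmi /dissipation /plant_next /plant_out /qform bform_mulmx.
rewrite col_mxKu col_mxKd !scaler0 !add0r !mulmxN -!mulNmx.
rewrite /col5_mx /row5_mx !mul_col_mx !mul_row_col !mul0mx !mul1mx.
rewrite !mul_scalar_mx !add0r !addr0 bform_dot !mul_col_mx !mul_row_col.
rewrite !mul0mx !mul1mx !add0r !addr0 !dotv_col !bform_block !bform0l !bform0r.
rewrite !add0r !bform_dot !dotvDr mul_scalar_mx.
rewrite [dotv (_ + _) w]dotvC dotvDr (mulNmx P33) dotvNr.
ring.
Qed.

Lemma synthesis_sym (P22 : R) P23 P33 : P33^T = P33 ->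
  (synthesis_lmi rho lam P22 P23 P23^T P33)^T = synthesis_lmi rho lam P22 P23 P23^T P33.
Proof.
move=> sP; rewrite /synthesis_lmi trmx_congr // /col5_mx /row5_mx.
have rowcol p1 p2 r1 r2 (a : 'M[R]_(p1, r1)) (b : 'M_(p1, r2)) (c : 'M_(p2, r1))
    (d : 'M_(p2, r2)) :
    row_mx (col_mx a c) (col_mx b d) = col_mx (row_mx a b) (row_mx c d).
  by rewrite -block_mxEh -block_mxEv.
rewrite !tr_col_mx !tr_row_mx !trmx0 !trmx1 trmxK tr_scalar_mx linearN /= sP.
by rewrite !rowcol.
Qed.

(** The functional g for which g^T x obeys a scalar recursion driven by w and z alone;
see coupling_vec_next. *)
Definition coupling_vec : 'cV[R]_(1 + s) :=
  col_mx (q rho lam)%:M (- (m / (l - m)) *: qbar rho lam).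

Lemma coupling_qform P22 P23 P32 P33 pbar x t :
  qform (coupling_mx m l rho lam P22 P23 P32 P33 pbar) (col_mx x t)
  = qform (block_mx P22%:M P23 P32 P33) x + 2 * t 0 0 * dotv coupling_vec x
    + pbar * t 0 0 ^+ 2.
Proof.
rewrite /coupling_mx /qform bform_block -/coupling_vec.
have -> : row_mx (q rho lam)%:M (- (m / (l - m)) *: qbar rho lam)^T = coupling_vec^T.
  by rewrite /coupling_vec tr_col_mx tr_scalar_mx.
rewrite -(bform_tr coupling_vec) !bform_dot !dotv1.
rewrite mul_scalar_mx -/(dotv coupling_vec x) mxE; ring.
Qed.

Lemma coupling_sym P22 P23 P33 pbar : P33^T = P33 ->
  (coupling_mx m l rho lam P22 P23 P23^T P33 pbar)^T
  = coupling_mx m l rho lam P22 P23 P23^T P33 pbar.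
Proof.
move=> sP; rewrite /coupling_mx !tr_block_mx !tr_col_mx !tr_row_mx.
by rewrite !trmxK !tr_scalar_mx sP.
Qed.

End Plant.

(** * The scalar recursion behind q and qbar *)

Section Recursion.
Variables (R : realType) (m l rho : R) (s : nat) (lam : 'rV[R]_s.+1).

(** Horner's rule: each entry of qbar is rho times the previous one plus the next
coefficient of the filter. *)
Lemma qbar_psiA : rho *: ((qbar rho lam)^T *m psiA R s) + psiC lam = (qbar rho lam)^T.
Proof.
apply/rowP => -[j hj]; rewrite !mxE.
have -> : \sum_j0 (qbar rho lam)^T 0 j0 * psiA R s j0 (Ordinal hj)
  = if j is j'.+1 then \sum_(k < j'.+1) rho ^+ k * lam 0 (inord (s - j' + k)) else 0.
  case: j hj => [|j] hj.
    by rewrite big1 // => i _; rewrite !mxE mulr0.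
  rewrite (bigD1 (Ordinal (ltnW hj))) //= big1 ?addr0; last first.
    move=> i ne; rewrite !mxE /=; case: eqP => [[E]|]; last by rewrite mulr0.
    by move: ne; rewrite -val_eqE /= E eqxx.
  by rewrite !mxE /= eqxx mulr1.
case: j hj => [|j] hj; first by rewrite mulr0 add0r big_ord1 expr0 mul1r addn0.
rewrite [RHS]big_ord_recl expr0 mul1r addn0 addrC; congr (_ + _).
rewrite mulr_sumr; apply: eq_bigr => k _; rewrite lift0 exprS mulrA.
by rewrite addnS -addSn subnSK // ltnW.
Qed.

(** One more Horner step after the last entry of qbar gives q. *)
Lemma qbar_psiB : rho * ((qbar rho lam)^T *m psiB R s) 0 0 = q rho lam - lam 0 0.
Proof.
rewrite /q big_ord_recl expr0 mul1r addrAC subrr add0r mxE.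
case: s lam => [|s'] lam'; first by rewrite !big_ord0 mulr0.
rewrite (bigD1 ord_max) //= big1 ?addr0; last first.
  move=> i ne; rewrite !mxE /= eqSS; case: eqP => [E|]; last by rewrite mulr0.
  by move: ne; rewrite -val_eqE /= E eqxx.
rewrite !mxE /= eqxx mulr1 mulr_sumr; apply: eq_bigr => k _.
rewrite exprS mulrA subSnn add1n; congr (_ * lam' _ _).
by apply: ord_inj; rewrite lift0 inordK // ltnS ltn_ord.
Qed.

(** The contribution of the filter register telescopes by Horner's rule, and what is left
of the filter is its output z: with sigma = g^T x, a = l q / (l - m) and b = m / (l - m),
the recursion is rho sigma' = sigma + a w + b z whatever the control y does. *)
Lemma coupling_vec_next x y w : 0 < rho -> m < l ->
  rho * dotv (coupling_vec m l rho lam) (plant_next m l rho x y w)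
  = dotv (coupling_vec m l rho lam) x + l * q rho lam / (l - m) * w 0 0
    + m / (l - m) * plant_out m l lam x y w 0 0.
Proof.
move=> rho0 lm; rewrite -{2}(vsubmxK x) /coupling_vec /plant_next /plant_out !dotv_col.
set eta := usubmx x; set psi := dsubmx x; set v := (l - m) *: y - w.
rewrite !dotvZl !dotv1 dotvDr.
have eA : rho * dotv (qbar rho lam) (psiA R s *m psi)
   = dotv (qbar rho lam) psi - (psiC lam *m psi) 0 0.
  rewrite /dotv mulmxA -{2}qbar_psiA mulmxDl -scalemxAl !mxE; ring.
have eB : rho * dotv (qbar rho lam) (psiB R s *m v) = (q rho lam - lam 0 0) * v 0 0.
  by rewrite /dotv mulmxA mxE big_ord1 mulrA qbar_psiB.
have vE : v 0 0 = (l - m) * y 0 0 - w 0 0 by rewrite !mxE.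
have lm0 : l - m != 0 by lra.
rewrite mulrDr mulrDr mulrDr [rho * (_ * dotv _ (psiA _ _ *m _))]mulrCA eA.
rewrite [rho * (_ * dotv _ (psiB _ _ *m _))]mulrCA eB.
have -> : (psiC lam *m psi + psiD lam *m v) 0 0 = (psiC lam *m psi) 0 0 + lam 0 0 * v 0 0.
  by rewrite mxE mul_scalar_mx [in X in _ + X]mxE.
have -> : (rho^-1 *: (eta + m *: y + w)) 0 0 = rho^-1 * (eta 0 0 + m * y 0 0 + w 0 0).
  by rewrite !mxE.
rewrite vE mxE mulr1n.
by field; rewrite lm0 lt0r_neq0.
Qed.

End Recursion.

(** * Sign conditions on the filter coefficients *)

Section Signs.
Variables (R : realType) (rho : R) (s : nat) (lam : 'rV[R]_s.+1).

(** The coefficients after lam_0 are nonpositive, so smaller weights than rho^-j can only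
increase the sum. Applied to the weights of lam_0, of the plain sum and of q. *)
Lemma weighted_sum_ge_nu (c : nat -> R) :
  (forall j : 'I_s.+1, (0 < j)%N -> lam 0 j <= 0) ->
  c 0%N = 1 -> (forall j, c j <= rho ^- j) ->
  nu rho lam <= \sum_(j < s.+1) c j * lam 0 j.
Proof.
move=> lamN c0 cle; apply: ler_sum => -[[|j] hj] _ /=.
  by rewrite c0 expr0 invr1.
by rewrite ler_wnM2r // lamN.
Qed.

Lemma invX_ge1 j : 0 < rho -> rho <= 1 -> 1 <= rho ^- j.
Proof.
by move=> r0 r1; rewrite invf_ge1 ?exprn_gt0 // exprn_ile1 // ltW.
Qed.

Lemma nu_le_lam0 : 0 < rho ->
  (forall j : 'I_s.+1, (0 < j)%N -> lam 0 j <= 0) -> nu rho lam <= lam 0 0.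
Proof.
move=> r0 lamN.
apply: le_trans (weighted_sum_ge_nu (c := fun j => (j == 0)%:R) lamN _ _) _ => //.
  move=> [|j] /=; first by rewrite expr0 invr1.
  by rewrite invr_ge0 exprn_ge0 // ltW.
rewrite big_ord_recl mul1r big1 ?addr0 // => i _.
by rewrite lift0 mul0r.
Qed.

Lemma nu_le_sum : 0 < rho -> rho <= 1 ->
  (forall j : 'I_s.+1, (0 < j)%N -> lam 0 j <= 0) ->
  nu rho lam <= \sum_(j < s.+1) lam 0 j.
Proof.
move=> r0 r1 lamN.
have := weighted_sum_ge_nu (c := fun=> 1) lamN (erefl _).
under eq_bigr => j _ do rewrite mul1r.
by apply => j; apply: invX_ge1.
Qed.

Lemma nu_le_q : 0 < rho -> rho <= 1 ->
  (forall j : 'I_s.+1, (0 < j)%N -> lam 0 j <= 0) -> nu rho lam <= q rho lam.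
Proof.
move=> r0 r1 lamN.
apply: (weighted_sum_ge_nu (c := fun j => rho ^+ j) lamN) => [|j].
  by rewrite expr0.
by apply: le_trans (invX_ge1 j r0 r1); rewrite exprn_ile1 // ltW.
Qed.

End Signs.

(** * Necessity of the scalar inequality *)

Section Necessity.
Variables (R : realType) (m l rho : R) (s : nat) (lam : 'rV[R]_s.+1).

(** Let J be the form X'^T P X' - X^T P X + 2 w z on quadruples (X', X, w, z). The
trajectories of the closed loop form a subspace on which J is negative definite, and its
dimension is the number of negative squares of J; hence J is positive on every nonzero
vector J-orthogonal to it. By coupling_vec_next, the vector (rho X, X, -b, -a) with
X = P^-1 G is J-orthogonal, and the value of J there is the right-hand side. The proof
compares this vector with the trajectory that has the same X and the same w - z: J is
nonnegative on the difference and negative on the trajectory. *)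
Lemma dual_inequality k (Ac : 'M[R]_k) Bc Cc Dc (P : 'M[R]_(k + 1 + s))
    (G : 'cV[R]_(k + 1 + s)) :
  0 < m -> m < l -> 0 < rho -> 0 <= lam 0 0 ->
  posdefmx P ->
  negdefmx (analysis_lmi m l rho lam (algA Ac Bc) (algB R k) (algC Cc Dc) P) ->
  G = closed_state 0 (coupling_vec m l rho lam) ->
  0 < rho ^+ 2 * qform (invmx P) G - qform (invmx P) G
      + 2 * m * l / (l - m) ^+ 2 * q rho lam.
Proof.
move=> m0 lm r0 lam0 hP [_ hN] GE.
have uP := posdef_unit hP; have sP := hP.1.
set X := invmx P *m G; have PX : P *m X = G by rewrite mulmxA mulmxV // mul1mx.
have piE : qform (invmx P) G = qform P X.
  by rewrite /qform !bform_dot PX dotvC.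
have [xi [x XE]] := closed_stateP X.
set y := Cc *m xi + Dc%:M *m usubmx x.
pose a := l * q rho lam / (l - m); pose b := m / (l - m).
have b0 : 0 < b by rewrite divr_gt0 // subr_gt0.
(* w0 solves w - z = a - b, where z is affine in w with slope - lam_0. *)
pose w0 := (a - b + (plant_out m l lam x y 0) 0 0) / (1 + lam 0 0).
pose w : 'cV[R]_1 := w0%:M.
have wE : w 0 0 = w0 by rewrite mxE mulr1n.
set z := (plant_out m l lam x y w) 0 0.
have zE : z = (plant_out m l lam x y 0) 0 0 - lam 0 0 * w0.
  rewrite /z /plant_out /psiD subr0 !mul_scalar_mx !mxE mulr1n; ring.
(* So the supply part of the difference with the normal vector lies on the line
   w = z, where w z >= 0. *)
have wz : w0 + b = z + a by rewrite zE /w0; field; lra.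
set Xn := closed_state (rho^-1 *: (Ac *m xi + Bc *m usubmx x)) (plant_next m l rho x y w).
have GXn : rho * bform P X Xn = qform P X + a * w0 + b * z.
  have -> : qform P X = dotv (coupling_vec m l rho lam) x.
    by rewrite /qform bform_dot PX dotvC GE XE dotv_state.
  by rewrite -{1}wE -coupling_vec_next // bformC // bform_dot PX dotvC GE dotv_state.
have negV : qform P Xn - qform P X + 2 * (w0 * z) < 0.
  have v0 : col_mx X w != 0.
    (* The trajectory is not zero: otherwise G = 0, hence q = 0 and a = 0, and
       w0 + b = z + a would read b = 0. *)
    apply: contraTneq b0 => /eqP; rewrite col_mx_eq0 => /andP [/eqP X0 /eqP w00].
    have G0 : G = 0 by rewrite -PX X0 mulmx0.
    have q0 : q rho lam = 0.
      move: G0; rewrite GE /closed_state /coupling_vec col_mxKu => /eqP.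
      rewrite !col_mx_eq0 => /andP [/andP [_ /eqP/matrixP/(_ 0 0)]].
      by rewrite !mxE mulr1n.
    have w0E : w0 = 0 by rewrite -wE w00 mxE.
    have x0 : x = 0 by rewrite -(plant_part_state xi x) -XE X0 mulmx0.
    have xi0 : xi = 0.
      have := X0; rewrite XE /closed_state => /eqP.
      by rewrite !col_mx_eq0 => /andP [/andP [/eqP ->]].
    have y0 : y = 0 by rewrite /y xi0 x0 !linear0 addr0.
    have z0 : z = 0.
      by rewrite /z x0 y0 w00 /plant_out !(linear0, subr0, addr0) mxE.
    by move: wz; rewrite w0E z0 /a q0 mulr0 mul0r !add0r => ->; rewrite ltxx.
  have : qform (analysis_lmi m l rho lam (algA Ac Bc) (algB R k) (algC Cc Dc) P)
    (col_mx X w) < 0 := hN _ v0.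
  rewrite XE analysis_qform -/y -/Xn dotv1 wE.
  by rewrite -/z -XE.
(* Nonnegativity of the storage part of the difference; with negV, GXn and sq the
   claim is now linear. *)
have Pge := posdef_ge0 (rho *: X + - Xn) hP.
move: Pge; rewrite qformD // qformZ qformN bformZl -scaleN1r bformZr => Pge.
have abE : 2 * m * l / (l - m) ^+ 2 * q rho lam = 2 * (a * b).
  by rewrite /a /b; field; lra.
rewrite abE piE.
have sq : 0 <= 2 * ((w0 + b) * (z + a)) by rewrite -wz mulr_ge0 // -expr2 sqr_ge0.
nra.
Qed.

End Necessity.

(** * Stability of the inverse filter *)

(** Convexity of the square: the weighted variance is nonnegative. *)
Lemma jensen_sqr (R : realType) n (w a : 'I_n -> R) (t b : R) :
  (forall i, 0 <= w i) -> 0 <= t -> \sum_i w i + t = 1 ->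
  (\sum_i w i * a i + t * b) ^+ 2 <= \sum_i w i * a i ^+ 2 + t * b ^+ 2.
Proof.
move=> w0 t0 wt; set v := _ + t * b.
have : 0 <= \sum_i w i * (a i - v) ^+ 2 + t * (b - v) ^+ 2.
  by apply: addr_ge0; first (apply: sumr_ge0 => i _); rewrite mulr_ge0 ?sqr_ge0.
have -> : \sum_i w i * (a i - v) ^+ 2
  = \sum_i w i * a i ^+ 2 - 2 * v * (\sum_i w i * a i) + v ^+ 2 * \sum_i w i.
  rewrite !mulr_sumr -sumrN -!big_split /=; apply: eq_bigr => i _; ring.
have -> : \sum_i w i * a i = v - t * b by rewrite /v addrK.
have -> : \sum_i w i = 1 - t by rewrite -wt addrK.
move=> h; rewrite -subr_ge0; apply: le_trans h _.
by rewrite le_eqVlt; apply/orP; left; apply/eqP; ring.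
Qed.

Lemma sum_lam_rev (R : realType) s (lam : 'rV[R]_s.+1) :
  \sum_(j < s.+1) lam 0 j = lam 0 0 + \sum_(i < s) lam 0 (inord (s - i)).
Proof.
rewrite big_ord_recl; congr (_ + _).
rewrite (reindex_inj rev_ord_inj) /=; apply: eq_bigr => i _; congr (lam _ _).
apply: ord_inj; rewrite lift0 inordK; last by rewrite ltnS leq_subr.
by rewrite /= subnSK.
Qed.

(** Let the filter be inverted: the entry v pushed into the register is determined by the
output z. Because lam_0 exceeds the sum of the moduli of the other coefficients, v is a
convex combination of the register entries and of a multiple of z, so Jensen bounds v^2 by
the same combination of squares. Weights c_i that increase along the register by a little
more than the coefficients of that combination turn this into a Lyapunov function for the
inverse filter (the zero dynamics), up to a multiple of z^2. *)
Lemma zero_dynamics_lyapunov (R : realType) (s : nat) (lam : 'rV[R]_s.+1) :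
  (forall j : 'I_s.+1, (0 < j)%N -> lam 0 j <= 0) ->
  0 < lam 0 0 -> 0 < \sum_(j < s.+1) lam 0 j ->
  exists c : 'I_s -> R, exists2 kappa, 0 < kappa & exists2 Gam, 0 <= Gam &
  (forall i, 0 < c i) /\
  forall (psi : 'cV[R]_s) (v : 'cV[R]_1),
   \sum_i c i * (psiA R s *m psi + psiB R s *m v) i 0 ^+ 2
   - \sum_i c i * psi i 0 ^+ 2
   <= Gam * ((psiC lam *m psi + psiD lam *m v) 0 0) ^+ 2 - kappa * \sum_i psi i 0 ^+ 2.
Proof.
move=> lamN l0 sl0.
(* In units of lam_0, mu k is the weight of psi_k in the new entry v, and tau is
   what these nonnegative weights leave to 1. The small kappa makes the decrease strict;
   it is divided by s + 1 rather than s so that s = 0 is covered and C s <= 1. *)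
pose mu (k : nat) := - lam 0 (inord (s - k)) / lam 0 0.
pose tau := (\sum_(j < s.+1) lam 0 j) / lam 0 0.
pose kappa := tau / s.+1%:R.
have tau0 : 0 < tau by rewrite divr_gt0.
have kappa0 : 0 < kappa by rewrite divr_gt0 ?ltr0n.
have mu0 (i : 'I_s) : 0 <= mu i.
  rewrite divr_ge0 ?(ltW l0) // oppr_ge0 lamN // inordK ?subn_gt0 //.
  by rewrite ltnS leq_subr.
have mutau : \sum_(i < s) mu i + tau = 1.
  rewrite /tau sum_lam_rev mulrDl divff ?lt0r_neq0 // addrCA -[RHS]addr0; congr (_ + _).
  rewrite mulr_suml -big_split big1 //= => i _.
  by rewrite /mu mulNr addNr.
pose C i := \sum_(k < i) (mu k + kappa).
have CS i : C i.+1 = C i + (mu i + kappa) by rewrite /C big_ord_recr.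
have C0 : C 0%N = 0 by rewrite /C big_ord0.
have Cpos i : (i <= s)%N -> 0 <= C i.
  elim: i => [|i IH] si; first by rewrite C0.
  by rewrite CS addr_ge0 ?IH ?(ltnW si) // addr_ge0 ?(mu0 (Ordinal si)) // ltW.
have Cs1 : C s <= 1.
  rewrite -mutau /C big_split /= lerD2l sumr_const card_ord /kappa -[_ *+ s]mulr_natr.
  rewrite -mulrA ler_piMr ?(ltW tau0) // mulrC ler_pdivrMr ?ltr0n // mul1r ler_nat.
  exact: leqnSn.
exists (fun i : 'I_s => C i.+1), kappa => //.
exists (tau * (lam 0 0 * tau) ^- 2); first by rewrite mulr_ge0 ?invr_ge0 ?sqr_ge0 // ltW.
split=> [i|psi v].
  by rewrite CS ltr_wpDl ?Cpos ?(ltnW (ltn_ord i)) // ltr_wpDl.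
(* The register followed by the entry about to be pushed: one step shifts p. *)
pose p i := oapp (fun j : 'I_s => psi j 0) (v 0 0) (insub i).
have pE (i : 'I_s) : p i = psi i 0 by rewrite /p valK.
have ps : p s = v 0 0 by rewrite /p insubF // ltnn.
have nextE (i : 'I_s) : (psiA R s *m psi + psiB R s *m v) i 0 = p i.+1.
  rewrite mxE [X in _ + X]mxE big_ord1 [psiB _ _ _ _]mxE.
  rewrite mxE; have [is'|si] := ltnP i.+1 s.
    rewrite (bigD1 (Ordinal is')) //= big1 ?addr0; last first.
      move=> j ne; rewrite mxE; case: eqP => [E|]; last by rewrite mul0r.
      by move: ne; rewrite -val_eqE /= E eqxx.
    by rewrite mxE /= eqxx mul1r ltn_eqF // mul0r addr0 -(pE (Ordinal is')).
  have Es : i.+1 = s by apply/eqP; rewrite eqn_leq si ltn_ord.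
  rewrite big1 => [|j _]; first by rewrite Es eqxx mul1r add0r ps.
  by rewrite mxE Es ltn_eqF // mul0r.
have shift : \sum_(i < s) C i.+1 * p i.+1 ^+ 2
    = \sum_(i < s) C i * p i ^+ 2 + C s * v 0 0 ^+ 2.
  rewrite -ps -(big_ord_recr s (fun i => C i * p i ^+ 2)) big_ord_recl C0 mul0r /= add0r.
  exact: eq_bigr.
under eq_bigr => i _ do rewrite nextE.
rewrite shift; set z := (psiC lam *m psi + _) 0 0.
have vE : v 0 0 = \sum_(i < s) mu i * psi i 0 + tau * (z / (lam 0 0 * tau)).
  have -> : z = \sum_(i < s) lam 0 (inord (s - i)) * psi i 0 + lam 0 0 * v 0 0.
    rewrite /z mxE mul_scalar_mx [X in _ + X]mxE mxE; congr (_ + _).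
    by apply: eq_bigr => i _; rewrite mxE.
  have -> : \sum_(i < s) mu i * psi i 0
     = - (\sum_(i < s) lam 0 (inord (s - i)) * psi i 0) / lam 0 0.
    by rewrite mulNr mulr_suml -sumrN; apply: eq_bigr => i _; rewrite /mu; ring.
  by field; rewrite !lt0r_neq0.
have := jensen_sqr (fun i => psi i 0) (z / (lam 0 0 * tau)) mu0 (ltW tau0) mutau.
rewrite -vE => jen.
have diff : \sum_(i < s) C i * p i ^+ 2 - \sum_(i < s) C i.+1 * psi i 0 ^+ 2
  = - \sum_(i < s) mu i * psi i 0 ^+ 2 - kappa * \sum_(i < s) psi i 0 ^+ 2.
  rewrite mulr_sumr -!sumrN -!big_split /=; apply: eq_bigr => i _.
  rewrite pE CS; ring.
rewrite addrAC diff.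
have Cv : C s * v 0 0 ^+ 2 <= v 0 0 ^+ 2 by rewrite ler_piMl ?sqr_ge0.
move: jen; rewrite expr_div_n; lra.
Qed.

(** * Feedback with full information *)

Section Feedback.
Variables (R : realType) (m l rho : R) (s : nat) (lam : 'rV[R]_s.+1).

(** The form (g^T x)^2 / pbar is the storage of the scalar recursion for g^T x; it is
in general only semidefinite, and a small Lyapunov term makes it definite. *)
Definition feedback_storage (pbar eps : R) (V : 'M[R]_(1 + s)) : 'M[R]_(1 + s) :=
  pbar^-1 *: (coupling_vec m l rho lam *m (coupling_vec m l rho lam)^T) + eps *: V.

Lemma qform_feedback_storage pbar eps V x :
  qform (feedback_storage pbar eps V) x
  = pbar^-1 * dotv (coupling_vec m l rho lam) x ^+ 2 + eps * qform V x.
Proof. by rewrite /qform bformD !bformZ -!/(qform _ _) qform_rank1. Qed.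

(** The recursion rho sigma' = sigma + a w + b z with storage sigma^2 / p, when z may depend
on sigma and w. The displayed z is the minimizer of the left-hand side over z, which is
convex in z; completing squares leaves a form in r and u that is negative definite exactly
when de > 0. *)
Lemma scalar_feedback (a b p sg W z : R) :
  0 < b -> 0 < p ->
  let u := W / b in
  let de := rho ^+ 2 * p - p + 2 * (a * b) in
  let r := sg + p * u in
  0 < rho ->
  z = - (r + (de - a * b) * u) / b ->
  p^-1 * ((sg + a * W + b * z) / rho) ^+ 2 - p^-1 * sg ^+ 2 + 2 * (W * z)
   = - r ^+ 2 / p - de * u ^+ 2 /\
  z ^+ 2 <= 2 / b ^+ 2 * (r ^+ 2 + (de - a * b) ^+ 2 * u ^+ 2).
Proof.
move=> b0 p0 u de r r0 ->; split.
  by rewrite /r /de /u; field; rewrite !lt0r_neq0.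
rewrite -subr_ge0.
(* This is (x + y)^2 <= 2 (x^2 + y^2). *)
have -> : 2 / b ^+ 2 * (r ^+ 2 + (de - a * b) ^+ 2 * u ^+ 2)
    - (- (r + (de - a * b) * u) / b) ^+ 2
 = ((r - (de - a * b) * u) / b) ^+ 2 by field; rewrite lt0r_neq0.
exact: sqr_ge0.
Qed.

(** A feedback that knows x and w can prescribe the filter output z. The choice of z in
scalar_feedback is optimal for sigma = g^T x and decreases the storage in the two directions
sigma and w; all other directions of the state are seen by the inverse filter, whose
Lyapunov function decreases up to a multiple of z^2, and a small eps pays for that multiple
out of the first decrease. *)
Lemma state_feedback pbar :
  0 < m -> m < l -> 0 < rho -> rho <= 1 -> 0 < nu rho lam ->
  (forall j : 'I_s.+1, (0 < j)%N -> lam 0 j <= 0) ->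
  0 < pbar ->
  0 < rho ^+ 2 * pbar - pbar + 2 * m * l / (l - m) ^+ 2 * q rho lam ->
  exists2 V : 'M[R]_(1 + s),
    [/\ V^T = V, forall x, 0 <= qform V x &
     forall x, qform V x <= 0 -> dotv (coupling_vec m l rho lam) x = 0 -> x = 0] &
    exists2 eps0, 0 < eps0 & forall eps, 0 < eps -> eps <= eps0 ->
      forall x w, (x != 0) || (w != 0) ->
        exists y, dissipation m l rho lam (feedback_storage pbar eps V) x y w < 0.
Proof.
move=> m0 lm r0 r1 nu0 lamN p0 de0.
have l0 : 0 < lam 0 0 := lt_le_trans nu0 (nu_le_lam0 r0 lamN).
have q0 : 0 < q rho lam := lt_le_trans nu0 (nu_le_q r0 r1 lamN).
have sl0 : 0 < \sum_(j < s.+1) lam 0 j := lt_le_trans nu0 (nu_le_sum r0 r1 lamN).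
have lm0 : 0 < l - m by rewrite subr_gt0.
have [c [kappa kappa0 [Gam Gam0 [cpos lyap]]]] := zero_dynamics_lyapunov lamN l0 sl0.
pose V : 'M[R]_(1 + s) := block_mx 0 0 0 (diag_mx (\row_i c i)).
have VE x : qform V x = \sum_i c i * dsubmx x i 0 ^+ 2.
  rewrite -{1}(vsubmxK x) /qform bform_block !bform0M !add0r -/(qform _ _) qform_diag.
  by apply: eq_bigr => i _; rewrite mxE.
have g0 x : dsubmx x = 0 -> dotv (coupling_vec m l rho lam) x = 0 -> x = 0.
  move=> x2; rewrite -(vsubmxK x) x2 /coupling_vec dotv_col dotv1 mxE mulr1n.
  rewrite dotv0 addr0 => /eqP.
  rewrite mulf_eq0 gt_eqF //= => /eqP x1.
  by rewrite [usubmx x]mx11_scalar x1 raddf0 col_mx0.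
exists V.
  split=> [|x|x].
  - by rewrite /V tr_block_mx !trmx0 tr_diag_mx.
  - by rewrite VE sumr_ge0 // => i _; rewrite mulr_ge0 ?sqr_ge0 // ltW.
  - rewrite VE => le0; apply: g0; apply/colP => i; rewrite [RHS]mxE; apply/eqP.
    have: \sum_i c i * dsubmx x i 0 ^+ 2 == 0.
      by rewrite eq_le le0 sumr_ge0 // => j _; rewrite mulr_ge0 ?sqr_ge0 // ltW.
    rewrite psumr_eq0 => [/allP h|j _]; last by rewrite mulr_ge0 ?sqr_ge0 // ltW.
    have := h i (mem_index_enum _).
    by rewrite mulf_eq0 gt_eqF // sqrf_eq0.
pose a := l * q rho lam / (l - m); pose b := m / (l - m).
have b0 : 0 < b by rewrite divr_gt0.
have abE : 2 * m * l / (l - m) ^+ 2 * q rho lam = 2 * (a * b).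
  by rewrite /a /b; field; rewrite lt0r_neq0.
rewrite abE in de0; set de := rho ^+ 2 * pbar - pbar + _ in de0.
(* D is chosen so that eps <= 1/D lets the term in z of the Lyapunov decrease use up
   at most half of the decrease in r and in u (B1 and B2 below). *)
pose Th := Gam * (2 / b ^+ 2); pose k := (de - a * b) ^+ 2.
have k0 : 0 <= k by rewrite sqr_ge0.
have Th0 : 0 <= Th by rewrite mulr_ge0 // divr_ge0 // sqr_ge0.
pose D := 1 + 2 * Th * pbar + 2 * Th * k / de.
have D1 : 0 <= 2 * Th * pbar by rewrite mulr_ge0 ?(ltW p0) // mulr_ge0.
have D2 : 0 <= 2 * Th * k / de.
  exact: divr_ge0 (mulr_ge0 (mulr_ge0 _ Th0) k0) (ltW de0).
have D0 : 0 < D by rewrite /D; lra.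
exists D^-1; first by rewrite invr_gt0.
move=> eps e0 eD x w xw.
have eDle : eps * D <= 1 by rewrite -ler_pdivlMr // div1r.
have eTp : eps * Th <= (pbar)^-1 / 2.
  rewrite ler_pdivlMr // -[pbar^-1]mul1r ler_pdivlMr //.
  by have := mulr_ge0 (ltW e0) D2; move: eDle; rewrite /D; lra.
have eTk : eps * Th * k <= de / 2.
  have : eps * (2 * Th * k / de) <= 1.
    by have := mulr_ge0 (ltW e0) D1; move: eDle; rewrite /D; lra.
  by rewrite mulrA ler_pdivrMr // mul1r; lra.
set g := coupling_vec m l rho lam.
pose sg := dotv g x; pose W := w 0 0; pose u := W / b.
pose r := sg + pbar * u.
pose z := - (r + (de - a * b) * u) / b.
(* Since lam_0 and l - m are invertible, y can steer the filter output to z. *)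
pose y : 'cV[R]_1 := (((z - (psiC lam *m dsubmx x) 0 0) / lam 0 0 + W) / (l - m))%:M.
have outE : plant_out m l lam x y w 0 0 = z.
  rewrite /plant_out /psiD mul_scalar_mx mxE [X in _ + X]mxE [(_ *: y - w) 0 0]mxE.
  rewrite [(_ *: y) 0 0]mxE [y 0 0]mxE mulr1n [(- w) 0 0]mxE -/W.
  by field; rewrite !lt0r_neq0.
exists y; rewrite /dissipation !qform_feedback_storage -/g -/sg dotv1 outE -/W.
have nextE : dotv g (plant_next m l rho x y w) = (sg + a * W + b * z) / rho.
  rewrite -outE -coupling_vec_next // mulrC mulKf // lt0r_neq0 //.
have [flowE zle] := @scalar_feedback a b pbar sg W z b0 p0 r0 erefl.
rewrite -/u -/de -/r in flowE zle.
have := lyap (dsubmx x) ((l - m) *: y - w).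
rewrite -[X in Gam * X ^+ 2]/(plant_out m l lam x y w 0 0) outE.
rewrite -[X in psiA R s *m _ + X]/(psiB R s *m ((l - m) *: y - w)).
rewrite -VE.
have -> : \sum_i c i * (psiA R s *m dsubmx x + psiB R s *m ((l - m) *: y - w)) i 0 ^+ 2
   = qform V (plant_next m l rho x y w) by rewrite VE col_mxKd.
rewrite nextE => Vle.
set N := \sum_i _ in Vle.
have N0 : 0 <= N by apply: sumr_ge0 => i _; rewrite sqr_ge0.
have Gz : eps * (Gam * z ^+ 2) <= eps * Th * r ^+ 2 + eps * Th * k * u ^+ 2.
  have := ler_wpM2l (mulr_ge0 (ltW e0) Gam0) zle; rewrite /Th -/k; lra.
have eV := ler_wpM2l (ltW e0) Vle.
have B1 : eps * Th * r ^+ 2 <= r ^+ 2 / pbar / 2.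
  by have := ler_wpM2r (sqr_ge0 r) eTp; lra.
have B2 : eps * Th * k * u ^+ 2 <= de / 2 * u ^+ 2.
  by rewrite ler_wpM2r ?sqr_ge0.
(* At least one of the three decrease terms is strict: if r, u and psi vanish, so do
   sigma and w, and then eta, because q > 0. *)
have total : (0 < r ^+ 2 / pbar) || (0 < de * u ^+ 2) || (0 < eps * kappa * N).
  apply: contraTT xw; rewrite !negb_or -!leNgt => /andP [/andP [rl ul] Nl].
  have u00 : u = 0.
    move: ul; rewrite pmulr_rle0 // => ul.
    by apply/eqP; rewrite -sqrf_eq0 eq_le ul sqr_ge0.
  have r00 : r = 0.
    move: rl; rewrite pmulr_lle0 ?invr_gt0 // => rl.
    by apply/eqP; rewrite -sqrf_eq0 eq_le rl sqr_ge0.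
  have x2 : dsubmx x = 0.
    by apply: sumsq_eq0; move: Nl; rewrite pmulr_rle0 // mulr_gt0.
  have sg0 : sg = 0 by move: r00; rewrite /r u00 mulr0 addr0.
  have W0 : W = 0.
    by move/eqP: u00; rewrite mulf_eq0 invr_eq0 (gt_eqF b0) orbF => /eqP.
  have w0 : w = 0 by rewrite [w]mx11_scalar -/W W0 raddf0.
  by rewrite (g0 x x2 sg0) w0 !eqxx.
have T1 : 0 <= r ^+ 2 / pbar by rewrite divr_ge0 ?sqr_ge0 // ltW.
have T2 : 0 <= de * u ^+ 2 by rewrite mulr_ge0 ?sqr_ge0 // ltW.
have T3 : 0 <= eps * kappa * N by rewrite !mulr_ge0 // ltW.
case/orP: total => [/orP [] T|T]; lra.
Qed.

End Feedback.

(** * Construction of the controller *)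

Section Controller.
Variables (R : realType) (m l rho : R) (s : nat) (lam : 'rV[R]_s.+1).

(** An output feedback from two decoupled conditions: Ht is the storage seen with full
information, Ht + K the storage seen without measurement. The closed-loop storage puts K on
the difference of plant and controller state, and quadratic_elimination then selects the
controller. *)
Lemma controller_exists (Ht K : 'M[R]_(1 + s)) :
  0 < m -> 0 < rho -> posdefmx Ht -> posdefmx K ->
  (forall psi w, (psi != 0) || (w != 0) ->
     dissipation m l rho lam (Ht + K) (col_mx 0 psi) 0 w < 0) ->
  (forall x w, (x != 0) || (w != 0) ->
     exists y, dissipation m l rho lam Ht x y w < 0) ->
  exists (Ac : 'M[R]_(1 + s)) (Bc : 'cV[R]_(1 + s)) (Cc : 'rV[R]_(1 + s))
     (Dc : R) (P : 'M[R]_(1 + s + 1 + s)),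
  [/\ posdefmx P,
      negdefmx (analysis_lmi m l rho lam (algA Ac Bc) (algB R (1 + s)) (algC Cc Dc) P)
    & forall x, qform P (closed_state 0 x) = qform (Ht + K) x].
Proof.
move=> m0 r0 hHt hK est sf.
pose E := plant_part R s (1 + s).
pose N : 'M[R]_(1 + s, 1 + s + 1 + s) := row_mx (row_mx 1%:M 0) 0.
(* The form x^T Ht x + (x - xi)^T K (x - xi): the controller state xi plays the role of
   an estimate of the plant state x, and K penalizes the estimation error. *)
pose P := E^T *m Ht *m E + (E - N)^T *m K *m (E - N).
have PE xi x : qform P (closed_state xi x) = qform Ht x + qform K (x - xi).
  rewrite /P /qform bformD !bform_mulmx mulmxBl plant_part_state.
  by rewrite /N /closed_state !mul_row_col !mul0mx !addr0 mul1mx.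
have sP : P^T = P by rewrite /P linearD /= !trmx_congr //; [exact: hK.1|exact: hHt.1].
have hP : posdefmx P.
  split=> // X Xn0; have [xi [x XE]] := closed_stateP X.
  rewrite -/(bform P X X) -/(qform P X) XE PE.
  have [x0|xn0] := eqVneq x 0; last first.
    by rewrite ltr_pwDl ?posdef_ge0 ?posdef_gt0.
  rewrite ltr_wpDl ?posdef_ge0 // posdef_gt0 // x0 sub0r oppr_eq0.
  by apply: contraNneq Xn0 => xi0; rewrite XE closed_state_eq0 xi0 x0 !eqxx.
clearbody P.
(* The unknowns are stacked as (xi, eta), known to the controller; (next xi, y), chosen
   by it; (psi, w), hidden from it. The S* read off the entries, T1 and T2 give the next
   and the current closed-loop state, Tz the filter output. *)
pose Seta : 'M[R]_(1, 1 + s + 1 + (1 + s + 1 + (s + 1))) := row_mx (row_mx 0 1%:M) 0.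
pose Sxi : 'M[R]_(1 + s, 1 + s + 1 + (1 + s + 1 + (s + 1))) :=
  row_mx 0 (row_mx (row_mx 1%:M 0) 0).
pose Sy : 'M[R]_(1, 1 + s + 1 + (1 + s + 1 + (s + 1))) :=
  row_mx 0 (row_mx (row_mx 0 1%:M) 0).
pose Spsi : 'M[R]_(s, 1 + s + 1 + (1 + s + 1 + (s + 1))) :=
  row_mx 0 (row_mx 0 (row_mx 1%:M 0)).
pose Sw : 'M[R]_(1, 1 + s + 1 + (1 + s + 1 + (s + 1))) :=
  row_mx 0 (row_mx 0 (row_mx 0 1%:M)).
pose Scur : 'M[R]_(1 + s + 1, 1 + s + 1 + (1 + s + 1 + (s + 1))) := row_mx 1%:M 0.
pose T1 := col_mx (col_mx Sxi (rho^-1 *: (Seta + m *: Sy + Sw)))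
  (psiA R s *m Spsi + psiB R s *m ((l - m) *: Sy - Sw)).
pose T2 := col_mx Scur Spsi.
pose Tz := psiC lam *m Spsi + psiD lam *m ((l - m) *: Sy - Sw).
pose F := T1^T *m P *m T1 - T2^T *m P *m T2 + (Sw^T *m Tz + Tz^T *m Sw).
have FE xi x xin y w :
  qform F (col_mx (col_mx xi (usubmx x)) (col_mx (col_mx xin y) (col_mx (dsubmx x) w)))
  = qform P (closed_state xin (plant_next m l rho x y w)) - qform P (closed_state xi x)
    + 2 * dotv w (plant_out m l lam x y w).
  set v := col_mx _ (col_mx _ _).
  have etaE : Seta *m v = usubmx x.
    by rewrite /Seta /v !mul_row_col !mul0mx mul1mx !(addr0, add0r).
  have xiE : Sxi *m v = xin.
    by rewrite /Sxi /v !mul_row_col !mul0mx mul1mx !(addr0, add0r).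
  have yE : Sy *m v = y by rewrite /Sy /v !mul_row_col !mul0mx mul1mx !(addr0, add0r).
  have psiE : Spsi *m v = dsubmx x.
    by rewrite /Spsi /v !mul_row_col !mul0mx mul1mx !(addr0, add0r).
  have wE : Sw *m v = w by rewrite /Sw /v !mul_row_col !mul0mx mul1mx !(addr0, add0r).
  have curE : Scur *m v = col_mx xi (usubmx x).
    by rewrite /Scur /v mul_row_col mul0mx mul1mx addr0.
  have vE : ((l - m) *: Sy - Sw) *m v = (l - m) *: y - w.
    by rewrite mulmxBl -scalemxAl yE wE.
  have zE : Tz *m v = plant_out m l lam x y w by rewrite mulmxDl -!mulmxA psiE vE.
  have T1E : T1 *m v = closed_state xin (plant_next m l rho x y w).
    rewrite /T1 !mul_col_mx xiE mulmxDl -!mulmxA psiE vE -scalemxAl !mulmxDl.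
    by rewrite -scalemxAl etaE yE wE /closed_state /plant_next col_mxKu col_mxKd.
  have T2E : T2 *m v = closed_state xi x by rewrite /T2 mul_col_mx curE psiE.
  have pairE (A B : 'M[R]_(1, 1 + s + 1 + (1 + s + 1 + (s + 1)))) :
      bform (A^T *m B) v v = dotv (A *m v) (B *m v).
    by rewrite bform_dot dotv_mull mulmxA.
  rewrite /F /qform !bformD bformN !bform_mulmx !pairE T1E T2E wE zE.
  by rewrite [dotv _ w]dotvC mulr2n mulrDl !mul1r.
have sF : F^T = F.
  have symm (A B : 'M[R]_(1, 1 + s + 1 + (1 + s + 1 + (s + 1)))) :
      (A^T *m B + B^T *m A)^T = A^T *m B + B^T *m A.
    by rewrite linearD /= !trmx_mul !trmxK addrC.
  by rewrite /F linearD linearB /= symm !trmx_congr.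
have Fstate xi x xin y w :
  qform F (col_mx (col_mx xi (usubmx x)) (col_mx (col_mx xin y) (col_mx (dsubmx x) w)))
  = dissipation m l rho lam Ht x y w
    + qform K (plant_next m l rho x y w - xin) - qform K (x - xi).
  by rewrite FE !PE /dissipation; ring.
(* Here xi and its successor are 0, so Ht and K act together as Ht + K. *)
have Fneg (d : 'cV[R]_(s + 1)) : d != 0 -> qform F (col_mx 0 (col_mx 0 d)) < 0.
  rewrite -(vsubmxK d); set psi := usubmx d; set w := dsubmx d => dn0.
  have := Fstate 0 (col_mx 0 psi) 0 0 w.
  rewrite col_mxKu col_mxKd !col_mx0 !subr0 => ->.
  have := est psi w; rewrite -negb_and -col_mx_eq0 => /(_ dn0).
  by rewrite /dissipation /qform !bformD; lra.
have Fpos (u : 'cV[R]_(1 + s + 1)) : u != 0 -> 0 < qform F (col_mx 0 (col_mx u 0)).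
  rewrite -(vsubmxK u); set xin := usubmx u; set y := dsubmx u => un0.
  have := Fstate 0 0 xin y 0.
  rewrite subr0 !linear0 !col_mx0 => ->.
  rewrite /dissipation /dotv trmx0 mul0mx mxE /qform !bform0l -!/(qform _ _).
  rewrite mulr0 addr0 !subr0.
  have [y0|yn0] := eqVneq y 0.
    have xn0 : plant_next m l rho (0 : 'cV[R]_(1 + s)) y 0 = 0.
      by rewrite y0 plant_next0.
    rewrite xn0 sub0r qformN /qform bform0l add0r -/(qform _ _) posdef_gt0 //.
    by move: un0; rewrite y0 col_mx_eq0 eqxx andbT.
  rewrite ltr_pwDl ?posdef_ge0 // posdef_gt0 //.
  rewrite /plant_next col_mx_eq0 negb_and linear0 add0r addr0 !scaler_eq0 invr_eq0.
  by rewrite (gt_eqF r0) (gt_eqF m0) yn0.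
have Fex (k : 'cV[R]_(1 + s + 1)) (d : 'cV[R]_(s + 1)) : k != 0 ->
    exists u, qform F (col_mx k (col_mx u d)) < 0.
  rewrite -(vsubmxK k) -(vsubmxK d).
  set xi := usubmx k; set eta := dsubmx k; set psi := usubmx d; set w := dsubmx d => kn0.
  pose x := col_mx eta psi.
  (* With x and w known, the next xi can be made equal to the next x, which removes the
     next estimation error. If x = w = 0, the current error -xi gives the strict decrease. *)
  have [y yP] : exists y, dissipation m l rho lam Ht x y w - qform K (x - xi) < 0.
    have [/andP [/eqP x0 /eqP w0]|xw] := boolP ((x == 0) && (w == 0)); last first.
      rewrite negb_and in xw; have [y yP] := sf x w xw.
      by exists y; have := posdef_ge0 (x - xi) hK; lra.
    exists 0; rewrite /dissipation x0 w0 plant_next0 sub0r.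
    rewrite qformN /dotv trmx0 mul0mx mxE /qform !bform0l !(mulr0, addr0, add0r, subr0).
    rewrite oppr0 sub0r oppr_lt0 posdef_gt0 //; apply: contraNneq kn0 => xi0.
    by move/eqP: x0; rewrite /x xi0 !col_mx_eq0 eqxx => /andP [].
  exists (col_mx (plant_next m l rho x y w) y).
  have := Fstate xi x (plant_next m l rho x y w) y w.
  rewrite col_mxKu col_mxKd => ->.
  by rewrite subrr /qform bform0l addr0.
have [L hL] := quadratic_elimination sF Fneg Fpos Fex.
(* The factor rho undoes the 1/rho in the update of the controller state. *)
exists (rho *: ulsubmx L), (rho *: ursubmx L), (dlsubmx L), (drsubmx L 0 0), P.
split=> // [|x]; last by rewrite PE subr0 /qform bformD.
split; first exact: analysis_sym.
move=> v; rewrite -(vsubmxK v); set w := dsubmx v.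
have [xi [x ->]] := closed_stateP (usubmx v) => vn0.
rewrite -/(bform _ _ _) -/(qform _ _) analysis_qform -mx11_scalar.
rewrite -!scalemxAl -scalerDr scalerA mulVf ?lt0r_neq0 // scale1r.
set xin := ulsubmx L *m xi + _; set y := dlsubmx L *m xi + _.
have LE : L *m col_mx xi (usubmx x) = col_mx xin y.
  by rewrite -{1}(submxK L) mul_block_col.
have := hL (col_mx xi (usubmx x)) (col_mx (dsubmx x) w).
rewrite LE FE; apply; apply: contraNT vn0.
rewrite (col_mx_eq0 (closed_state xi x)) closed_state_eq0 negb_or !negbK !col_mx_eq0.
move=> /andP [/andP [-> x1] /andP [x2 ->]].
by rewrite -(vsubmxK x) col_mx_eq0 x1 x2.
Qed.

(** If the determinant vanishes, the controller and the integrator have a common fixed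
point with output y = 0. The storage cannot decrease along it since rho <= 1. *)
Lemma det_neq0 k (Ac : 'M[R]_k) Bc Cc Dc (P : 'M[R]_(k + 1 + s)) :
  0 < rho -> rho <= 1 -> posdefmx P ->
  negdefmx (analysis_lmi m l rho lam (algA Ac Bc) (algB R k) (algC Cc Dc) P) ->
  \det (block_mx (Ac - 1%:M) Bc Cc Dc%:M) != 0.
Proof.
move=> r0 r1 hP [_ hN]; rewrite -unitfE -unitmxE; apply: unitmx_ker => v.
rewrite -(vsubmxK v); set xi := usubmx v; set eta := dsubmx v.
rewrite mul_block_col => /eqP; rewrite col_mx_eq0 => /andP [/eqP Axi /eqP y0].
have fix_xi : Ac *m xi + Bc *m eta = xi.
  by apply/eqP; rewrite -subr_eq0 -Axi mulmxBl mul1mx addrAC.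
apply/eqP/negPn/negP => vn0.
pose x : 'cV[R]_(1 + s) := col_mx eta 0.
have Xn0 : closed_state xi x != 0.
  by rewrite closed_state_eq0 /x !col_mx_eq0 eqxx andbT -col_mx_eq0.
have : qform (analysis_lmi m l rho lam (algA Ac Bc) (algB R k) (algC Cc Dc) P)
   (col_mx (closed_state xi x) 0) < 0 by apply: hN; rewrite col_mx_eq0 negb_and Xn0.
have xu : usubmx x = eta by rewrite col_mxKu.
have xd : dsubmx x = 0 by rewrite col_mxKd.
rewrite analysis_qform xu y0 fix_xi.
(* With w = 0 and psi = 0 the fixed point only feels the factor 1/rho >= 1. *)
have -> : closed_state (rho^-1 *: xi) (plant_next m l rho x 0 0)
   = rho^-1 *: closed_state xi x.
  rewrite /closed_state /plant_next col_mxKu col_mxKd xu xd !scale_col_mx.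
  by rewrite !scaler0 subr0 !mulmx0 !addr0.
rewrite qformZ /dotv trmx0 mul0mx mxE mulr0 addr0 ltNge => /negP; apply.
rewrite -[X in _ - X]mul1r -mulrBl mulr_ge0 ?posdef_ge0 // subr_ge0 exprVn.
exact: invX_ge1.
Qed.

End Controller.

(** * Equivalence of the analysis and synthesis conditions *)

Theorem theorem15 (R : realType) (m l btilde rho : R) (s : nat)
    (lam : 'rV[R]_s.+1)
    (hm : 0 < m) (hml : m < l) (hb : 0 < btilde)
    (hrho0 : 0 < rho) (hrho1 : rho <= 1) :
  (exists (Ac : 'M[R]_(1 + s)) (Bc : 'cV[R]_(1 + s)) (Cc : 'rV[R]_(1 + s))
          (Dc : R) (P : 'M[R]_(1 + s + 1 + s)),
     [/\ \det (block_mx (Ac - 1%:M) Bc Cc Dc%:M) != 0,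
         posdefmx P,
         negdefmx (analysis_lmi m l rho lam
                     (algA Ac Bc) (algB R (1 + s)) (algC Cc Dc) P),
         ((calB2 s rho (algB R (1 + s)))^T *m P
            *m calB2 s rho (algB R (1 + s))) 0 0
           - 2 * btilde * nu rho lam < 0 &
         (forall j : 'I_s.+1, (0 < j)%N -> lam 0 j <= 0) /\ 0 <= nu rho lam])
  <->
  (exists (P22 : R) (P23 : 'rV[R]_s) (P32 : 'cV[R]_s) (P33 : 'M[R]_s)
          (Pbar22 : R),
     [/\ P32 = P23^T /\
         (block_mx P22%:M P23 P32 P33 : 'M[R]_(1 + s))^T
           = block_mx P22%:M P23 P32 P33,
         negdefmx (synthesis_lmi rho lam P22 P23 P32 P33),
         0 < rho ^+ 2 * Pbar22 - Pbar22
             + 2 * m * l / (l - m) ^+ 2 * q rho lam,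
         posdefmx (coupling_mx m l rho lam P22 P23 P32 P33 Pbar22) &
         (forall j : 'I_s.+1, (0 < j)%N -> lam 0 j <= 0) /\
         rho ^- 2 * P22
           - 2 * btilde * (\sum_(j < s.+1) rho ^- j * lam 0 j) < 0]).
Proof.
have lm : 0 < l - m by rewrite subr_gt0.
have B2E (P : 'M[R]_(1 + s + 1 + s)) P22 P23 P32 P33 :
    (forall x, qform P (closed_state 0 x) = qform (block_mx P22%:M P23 P32 P33) x) ->
    ((calB2 s rho (algB R (1 + s)))^T *m P *m calB2 s rho (algB R (1 + s))) 0 0
    = rho ^- 2 * P22.
  move=> PH; pose x : 'cV[R]_(1 + s) := col_mx (rho^-1)%:M 0.
  have -> : calB2 s rho (algB R (1 + s)) = closed_state 0 x.
    rewrite /calB2 /closed_state /x col_mxKu col_mxKd /algB scale_col_mx scaler0.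
    by rewrite scalemx1.
  rewrite -/(bform _ _ _) -/(qform P _) PH /qform bform_block !bform0l !bform0r !addr0.
  by rewrite bform_dot dotv1 mul_scalar_mx !mxE !mulr1n mulrCA -expr2 exprVn mulrC.
split.
- move=> [Ac [Bc [Cc [Dc [P [_ hP hN hB [lamN nu0]]]]]]].
  have sP := hP.1.
  have lam0 : 0 <= lam 0 0 := le_trans nu0 (nu_le_lam0 hrho0 lamN).
  set G : 'cV[R]_(1 + s + 1 + s) := closed_state 0 (coupling_vec m l rho lam).
  have dual := dual_inequality hm hml hrho0 lam0 hP hN (erefl G).
  set pi := qform (invmx P) G in dual.
  set de := _ + _ in dual.
  pose E := plant_part R s (1 + s).
  pose H : 'M[R]_(1 + s) := E *m P *m E^T.
  have HE x : qform H x = qform P (closed_state 0 x) by exact: qform_plant_block.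
  have sH : H^T = H by rewrite /H -{1 3}[E]trmxK trmx_congr.
  have hH : posdefmx H.
    split=> // x xn0; rewrite -/(bform _ _ _) -/(qform H x) HE posdef_gt0 //.
    by rewrite closed_state_eq0 negb_and xn0 orbT.
  have PinvG : P *m (invmx P *m G) = G by rewrite mulmxA mulmxV ?mul1mx // posdef_unit.
  have piE : pi = dotv G (invmx P *m G) by rewrite /pi /qform bform_dot.
  have pi0 : 0 <= pi.
    by rewrite piE -{1}PinvG dotvC -bform_dot posdef_ge0.
  have cs x : dotv (coupling_vec m l rho lam) x ^+ 2 <= pi * qform H x.
    rewrite HE piE; have := dotv_sqr_le (closed_state 0 x) hP PinvG.
    by rewrite dotv_state.
  pose P22 := ulsubmx H 0 0; pose P23 := ursubmx H; pose P33 := drsubmx H.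
  have P32E : dlsubmx H = P23^T by rewrite /P23 trmx_ursub sH.
  have P33E : P33^T = P33 by rewrite /P33 trmx_drsub sH.
  have HB : block_mx P22%:M P23 P23^T P33 = H.
    by rewrite -P32E -mx11_scalar submxK.
  (* Cauchy-Schwarz allows any value above pi; half the slack de of the dual inequality
     keeps that inequality strict. *)
  exists P22, P23, P23^T, P33, (pi + de / 2).
  split; first by rewrite HB.
  + split; first exact: synthesis_sym.
    move=> v; rewrite -(vsubmxK v); set psi := usubmx v; set w := dsubmx v => vn0.
    rewrite -/(bform _ _ _) -/(qform _ _) (synthesis_qform m l) HB /dissipation.
    have : qform (analysis_lmi m l rho lam (algA Ac Bc) (algB R (1 + s)) (algC Cc Dc) P)
       (col_mx (closed_state 0 (col_mx 0 psi)) w) < 0.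
      apply: hN.2; rewrite col_mx_eq0 closed_state_eq0 eqxx /= col_mx_eq0 eqxx /=.
      by rewrite -col_mx_eq0.
    by rewrite analysis_qform col_mxKu !mulmx0 !addr0 scaler0 -!HE /dissipation.
  + rewrite -/de in dual *.
    have : rho ^+ 2 * (pi + de / 2) - (pi + de / 2) + 2 * m * l / (l - m) ^+ 2 * q rho lam
      = de * (1 + rho ^+ 2) / 2 by rewrite /de; field; rewrite lt0r_neq0.
    move=> ->; by rewrite divr_gt0 // mulr_gt0 // ltr_pwDl // sqr_ge0.
  + split; first exact: coupling_sym.
    move=> v; rewrite -(vsubmxK v); set x := usubmx v; set t := dsubmx v => vn0.
    rewrite -/(bform _ _ _) -/(qform _ _) coupling_qform HB.
    apply: (bordered_form_gt0 hH cs pi0); first by rewrite ltrDl divr_gt0.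
    move: vn0; rewrite col_mx_eq0 negb_and => /orP [->//|tn0].
    by apply/orP; right; apply: contraNneq tn0 => t0; rewrite [t]mx11_scalar t0 raddf0.
  + split=> //; rewrite -(B2E P P22 P23 P23^T P33) // => x.
    by rewrite HB HE.
- move=> [P22 [P23 [P32 [P33 [pbar [[P32E sB] hS hde hC [lamN hB]]]]]]].
  set H : 'M[R]_(1 + s) := block_mx P22%:M P23 P32 P33.
  set g := coupling_vec m l rho lam.
  have cpl x (t : R) : (x != 0) || (t != 0) ->
     0 < qform H x + 2 * t * dotv g x + pbar * t ^+ 2.
    move=> xt; have tE : (t%:M : 'M[R]_1) 0 0 = t by rewrite mxE mulr1n.
    rewrite -[in X in 2 * X]tE -[in X in X ^+ 2]tE -coupling_qform posdef_gt0 //.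
    rewrite col_mx_eq0 negb_and; case/orP: xt => [->//|tn0]; apply/orP; right.
    by apply: contraNneq tn0 => t0; rewrite -tE t0 mxE.
  have p0 : 0 < pbar.
    have := cpl 0 1; rewrite oner_neq0 orbT => /(_ isT).
    by rewrite /qform bform0l dotv0 mulr0 !add0r expr1n mulr1.
  (* The Schur complement of the coupling matrix with respect to its last entry. *)
  have hM0 : posdefmx (H - pbar^-1 *: (g *m g^T)).
    split; first by rewrite linearB linearZ /= trmx_mul trmxK /H sB.
    move=> x xn0; rewrite -/(bform _ _ _) -/(qform _ _).
    rewrite /qform bformD bformN bformZ -!/(qform _ _) qform_rank1.
    have := cpl x (- (dotv g x) / pbar); rewrite xn0 => /(_ isT).
    congr (_ < _); field; exact: lt0r_neq0.
  have P22_gt0 : 0 < P22.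
    pose e : 'cV[R]_(1 + s) := col_mx 1%:M 0.
    have := cpl e 0; rewrite /e col_mx_eq0 negb_and matrix_nonzero1 /= => /(_ isT).
    rewrite expr0n !mulr0 mul0r !addr0 /qform /H bform_block !bform0l !bform0r !addr0.
    by rewrite bform_dot mulmx1 dotv1 !mxE !mulr1n mul1r.
  have nu0 : 0 < nu rho lam.
    have r2 : 0 < rho ^- 2 * P22 by rewrite mulr_gt0 ?invr_gt0 ?exprn_gt0.
    have : 0 < 2 * btilde * nu rho lam by rewrite /nu; lra.
    by rewrite pmulr_rgt0 // mulr_gt0.
  have [V [sV V0 Vg] [eps0 eps00 sf]] :=
    state_feedback hm hml hrho0 hrho1 nu0 lamN p0 hde.
  have [Gm Gm0 VG] := posdef_dominates V hM0.
  (* Small enough for the state feedback, and for H to dominate the storage. *)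
  pose eps := Num.min eps0 (Gm + 1)^-1.
  have e0 : 0 < eps by rewrite lt_min eps00 invr_gt0 ltr_wpDl.
  have eG : eps * Gm < 1.
    have : eps * (Gm + 1) <= 1.
      by rewrite -ler_pdivlMr ?ltr_wpDl // div1r /eps ge_min lexx orbT.
    lra.
  pose Ht := feedback_storage m l rho lam pbar eps V.
  have sHt : Ht^T = Ht.
    by rewrite /Ht /feedback_storage linearD !linearZ /= trmx_mul trmxK sV.
  have hHt : posdefmx Ht.
    split=> // x xn0; rewrite -/(bform _ _ _) -/(qform _ _) qform_feedback_storage.
    have i1 : 0 <= pbar^-1 * dotv g x ^+ 2 by rewrite mulr_ge0 ?sqr_ge0 // invr_ge0 ltW.
    have i2 : 0 <= eps * qform V x by rewrite mulr_ge0 // ltW.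
    rewrite lt_neqAle addr_ge0 // andbT eq_sym; apply: contra xn0.
    rewrite paddr_eq0 // => /andP [].
    rewrite !mulf_eq0 invr_eq0 (gt_eqF p0) (gt_eqF e0) /=.
    rewrite orbb => /eqP gx /eqP Vx; apply/eqP/Vg => //.
    by rewrite Vx.
  have hK : posdefmx (H - Ht).
    split; first by rewrite linearB /= sHt /H sB.
    move=> x xn0; rewrite -/(bform _ _ _) -/(qform _ _).
    rewrite /qform bformD bformN -!/(qform _ _) qform_feedback_storage.
    have := posdef_gt0 hM0 xn0; have := VG x.
    rewrite /qform bformD bformN bformZ -!/(qform _ _) qform_rank1 -/g.
    set M0x := qform H x - _ => Vle M0.
    have : eps * qform V x < M0x.
      apply: (le_lt_trans (ler_wpM2l (ltW e0) Vle)).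
      by rewrite mulrA gtr_pMl.
    by rewrite /M0x; lra.
  have HtK : Ht + (H - Ht) = H by rewrite addrCA subrr addr0.
  have est psi w : (psi != 0) || (w != 0) ->
      dissipation m l rho lam (Ht + (H - Ht)) (col_mx 0 psi) 0 w < 0.
    move=> pw; rewrite HtK -synthesis_qform; apply: hS.2.
    by rewrite col_mx_eq0 negb_and.
  have eps_le : eps <= eps0 by rewrite ge_min lexx.
  have [Ac [Bc [Cc [Dc [P [hP hN PH]]]]]] :=
    controller_exists hm hrho0 hHt hK est (sf eps e0 eps_le).
  exists Ac, Bc, Cc, Dc, P; split=> //.
  + exact: det_neq0 hN.
  + rewrite (B2E P P22 P23 P32 P33) // => x; by rewrite PH HtK.
  + by split=> //; apply: ltW.
Qed.
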